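(* The following decision problem is NP-hard: given a triangle-free graph $G$, decide whether $G$ is perfectly divisible.
   Context: All graphs are finite and simple. A graph is triangle-free if it contains no clique on three vertices. For $S\subseteq V(G)$, $G[S]$ is the subgraph induced by $S$. $\omega(G)$ is the number of vertices in a largest clique of $G$ and $\chi(G)$ the chromatic number. A graph $G$ is perfect if $\chi(H)=\omega(H)$ for every induced subgraph $H$ of $G$. A partition $(A,B)$ of $V(G)$ is good if $G[A]$ is perfect and $\omega(G[B])<\omega(G)$. A graph $G$ is perfectly divisible if every induced subgraph $H$ of $G$ with at least one edge admits a good partition (of $V(H)$). *)

(* Defs.v *)
From mathcomp Require Import all_boot.
Set Implicit Arguments. Unset Strict Implicit. Unset Printing Implicit Defensive.

(* Part 1: graph notions.  A simple graph is a relation [e : rel T] on a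
   finite type T (symmetric and irreflexive where required).  Induced
   subgraphs G[S] are represented by vertex sets [S : {set T}].         *)
Section Graphs.
Variables (T : finType) (e : rel T).

Definition clique (K : {set T}) : bool :=
  [forall x in K, forall y in K, (x != y) ==> e x y].

Definition omega (S : {set T}) : nat :=
  \max_(K : {set T} | (K \subset S) && clique K) #|K|.

(* proper colouring of G[S] with colours in {0,...,k-1}
   (colour values are drawn from 'I_(|T|+1), which suffices) *)
Definition colorable (S : {set T}) (k : nat) : bool :=
  [exists f : {ffun T -> 'I_#|T|.+1},
     [forall x in S, (f x < k)%N] &&
     [forall x in S, forall y in S, e x y ==> (f x != f y)]].

(* chi(G[S]) : least k such that G[S] is k-colourable (k <= |T| always
   exists for an irreflexive relation) *)
Definition chi (S : {set T}) : nat :=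
  find (colorable S) (iota 0 #|T|.+1).

Definition perfect (A : {set T}) : Prop :=
  forall S : {set T}, S \subset A -> chi S = omega S.

Definition good_partition (V A B : {set T}) : Prop :=
  [/\ A :|: B = V, [disjoint A & B], perfect A & omega B < omega V].

Definition has_edge (V : {set T}) : Prop :=
  exists x y, [/\ x \in V, y \in V & e x y].

Definition perfectly_divisible : Prop :=
  forall V : {set T}, has_edge V -> exists A B, good_partition V A B.

Definition triangle_free : Prop :=
  forall K : {set T}, clique K -> #|K| < 3.

End Graphs.

(* Encoding of a graph on vertex set 'I_n as a bit string:
   n in unary, a separator, then the n x n adjacency matrix row by row. *)
Definition enc_graph (n : nat) (e : rel 'I_n) : seq bool :=
  nseq n true ++ false :: [seq e i j | i <- enum 'I_n, j <- enum 'I_n].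

(* Part 2: a standard computation model: deterministic single-tape
   Turing machines over the binary alphabet with blank symbol,
   two-way infinite tape.                                              *)
Inductive move := MLeft | MRight | MStay.

Record TM := {
  tm_state : finType;
  tm_start : tm_state;
  tm_halt : pred tm_state;
  tm_accept : pred tm_state;
  tm_delta : tm_state -> option bool -> tm_state * option bool * move
}.

(* configuration: state, cells left of head (nearest first), head cell,
   cells right of head (nearest first); cells not listed are blank *)
Record config (M : TM) := Config {
  cf_state : tm_state M;
  cf_left : seq (option bool);
  cf_head : option bool;
  cf_right : seq (option bool)
}.

Definition step (M : TM) (c : config M) : config M :=
  let: Config q l h r := c in
  if tm_halt q then c else
  let: (q', w, d) := tm_delta q h in
  match d with
  | MStay => Config q' l w r
  | MLeft => match l with
             | [::] => Config q' [::] None (w :: r)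
             | a :: l' => Config q' l' a (w :: r)
             end
  | MRight => match r with
              | [::] => Config q' (w :: l) None [::]
              | a :: r' => Config q' (w :: l) a r'
              end
  end.

Definition run (M : TM) (t : nat) (c : config M) : config M := iter t (@step M) c.

Definition init (M : TM) (x : seq bool) : config M :=
  match x with
  | [::] => Config (tm_start M) [::] None [::]
  | b :: x' => Config (tm_start M) [::] (Some b) (map Some x')
  end.

Fixpoint read_block (s : seq (option bool)) : seq bool :=
  match s with
  | Some b :: s' => b :: read_block s'
  | _ => [::]
  end.

Definition output (M : TM) (c : config M) : seq bool :=
  read_block (cf_head c :: cf_right c).

Definition halted (M : TM) (c : config M) : bool := tm_halt (cf_state c).

Definition polytime_fun (f : seq bool -> seq bool) : Prop :=
  exists (M : TM) (a k : nat), forall x : seq bool,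
    exists t, t <= a * size x ^ k + a /\
      let c := run t (init M x) in halted c /\ output c = f x.

Definition pair_enc (x y : seq bool) : seq bool :=
  flatten [seq [:: true; b] | b <- x] ++ false :: y.

Definition in_NP (L : pred (seq bool)) : Prop :=
  exists (M : TM) (a k b m : nat),
    (forall z : seq bool, exists t, t <= a * size z ^ k + a /\
        halted (run t (init M z))) /\
    (forall x : seq bool,
       L x <-> exists y : seq bool, size y <= b * size x ^ m + b /\
         exists t, let c := run t (init M (pair_enc x y)) in
                   halted c /\ tm_accept (cf_state c)).

(* Main.v *)
Require Import Defs.
From Stdlib Require Import ZArith FunctionalExtensionality.
From mathcomp Require Import all_boot zify.
Set Implicit Arguments. Unset Strict Implicit. Unset Printing Implicit Defensive.

(* A triangle-free perfect graph is bipartite, so a triangle-free graph is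
   perfectly divisible iff it is 3-colourable.  A verifier's computation on
   [pair_enc x y] is written as a tableau relative to the head position, in
   which the control state and every tape cell at time [t + 1] are determined by
   the control at time [t] and a single cell; hence the existence of an accepting
   [y] is the satisfiability of clauses [a /\ b -> p \/ p'].  Such a clause
   says that five literals, one of them constantly false, are not all equal,
   which a 5-cycle expresses for 3-colourings; no triangle arises because the
   "base" colour is available at two nonadjacent vertices, forced to agree by a
   Groetzsch graph with one edge removed.  The adjacency matrix is printed by a
   nest of loops over unary counters, and any such loop program is run in
   polynomial time by a stack machine whose stacks are interleaved on one tape. *)

(** * Triangle-free graphs: perfect divisibility is 3-colourability *)

(** Triangles are the obstacle. The usual gadgets for 3-colourings contain the palette triangle and,
    for each variable, the triangle of base, literal and negated literal; hence one base vertex for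
    each sign, and several vertices of colour false. The four literals left to a clause dictate the
    tableau: with cells numbered from the moving head, a new cell depends on the control and on one
    old cell, where fixed positions would require whole windows. Only clauses about the guessed
    certificate have two distinct conclusions; all others have at most one, so following them
    forwards from the first row suffices, whatever else a satisfying valuation makes true.

    Polynomial time is a statement about concrete single-tape machines, so the graph has to be
    printable by a very weak language. Every pair of indices therefore carries the same finite list
    of vertices, and whether a clause is in force is part of the adjacency, a propositional formula
    in the loop counters. *)

Section PerfectDivisibility.
Variables (T : finType) (e : rel T).
Hypotheses (e_sym : symmetric e) (e_irr : irreflexive e).

Definition edgeless (S : {set T}) := [forall x in S, forall y in S, ~~ e x y].

Lemma edgelessP (S : {set T}) :
  reflect {in S &, forall x y, ~~ e x y} (edgeless S).
Proof.
apply: (iffP forall_inP) => [H x y xS yS | H x xS].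
  by have /forall_inP := H x xS; apply.
by apply/forall_inP => y yS; exact: H.
Qed.

Lemma edgelessPn (S : {set T}) :
  reflect (exists x y, [/\ x \in S, y \in S & e x y]) (~~ edgeless S).
Proof.
apply: (iffP idP).
  rewrite negb_forall_in => /exists_inP[x xS]; rewrite negb_forall_in.
  by move=> /exists_inP[y yS]; rewrite negbK => exy; exists x, y.
by move=> [x [y [xS yS exy]]]; apply/edgelessP => /(_ x y xS yS); rewrite exy.
Qed.

Lemma clique1 x : clique e [set x].
Proof.
apply/forall_inP => y /set1P->; apply/forall_inP => z /set1P->.
by rewrite eqxx.
Qed.

Lemma clique2 x y : e x y -> clique e [set x; y].
Proof.
move=> exy; apply/forall_inP => u /set2P[] ->; apply/forall_inP => v /set2P[] ->;
  by rewrite ?eqxx ?exy ?[e y x]e_sym ?exy ?implybT.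
Qed.

Lemma omega_clique (S K : {set T}) : K \subset S -> clique e K -> #|K| <= omega e S.
Proof.
move=> KS cK; rewrite /omega.
by apply: (@leq_bigmax_cond _ (fun K : {set T} => (K \subset S) && clique e K) (fun K => #|K|));
  rewrite KS.
Qed.

Lemma omega_edge (S : {set T}) : ~~ edgeless S -> 2 <= omega e S.
Proof.
move/edgelessPn => [x [y [xS yS exy]]].
have nxy : x != y by apply: contraTneq exy => ->; rewrite e_irr.
have := @omega_clique S [set x; y]; rewrite cards2 nxy; apply; last exact: clique2.
by apply/subsetP => z /set2P[] ->.
Qed.

Lemma omega_edgeless (S : {set T}) : edgeless S -> omega e S = (S != set0).
Proof.
move=> /edgelessP H; apply/eqP; rewrite eqn_leq; apply/andP; split.
  apply/bigmax_leqP => K /andP[/subsetP KS /forall_inP cK].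
  have [->|/set0Pn[x xK]] := eqVneq K set0; first by rewrite cards0.
  have -> : S != set0 by apply/set0Pn; exists x; exact: KS.
  apply/card_le1_eqP => y z yK zK.
  have [//|nyz] := eqVneq y z.
  have /forall_inP/(_ z zK)/implyP/(_ nyz) := cK y yK.
  by rewrite (negbTE (H _ _ (KS _ yK) (KS _ zK))).
have [//|/set0Pn[x xS]] := eqVneq S set0.
by have := @omega_clique S [set x]; rewrite cards1 sub1set clique1; apply.
Qed.

Lemma chi_eq (S : {set T}) k : k <= #|T| -> colorable e S k ->
  (forall j, j < k -> ~~ colorable e S j) -> chi e S = k.
Proof.
move=> hk ck Hk; rewrite /chi.
have nthE j : j <= #|T| -> nth 0 (iota 0 #|T|.+1) j = j by move=> hj; rewrite nth_iota.
case: (ltngtP (find (colorable e S) (iota 0 #|T|.+1)) k) => // lt.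
  have h : has (colorable e S) (iota 0 #|T|.+1).
    by rewrite has_find size_iota; lia.
  have := nth_find 0 h; rewrite nthE; last lia.
  by rewrite (negbTE (Hk _ lt)).
by have := before_find 0 lt; rewrite nthE // ck.
Qed.

Lemma colorableI (S : {set T}) k (c : T -> nat) : k <= #|T|.+1 ->
  (forall x, x \in S -> c x < k) ->
  (forall x y, x \in S -> y \in S -> e x y -> c x != c y) -> colorable e S k.
Proof.
move=> hk H1 H2; apply/existsP; exists [ffun x => inord (c x)].
have val_c x : x \in S -> nat_of_ord (inord (c x) : 'I_#|T|.+1) = c x.
  by move=> xS; rewrite inordK //; have := H1 x xS; lia.
apply/andP; split.
  by apply/forall_inP => x xS; rewrite ffunE val_c ?H1.
apply/forall_inP => x xS; apply/forall_inP => y yS; apply/implyP => exy.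
rewrite !ffunE; apply: contra (H2 x y xS yS exy) => /eqP/(congr1 val)/=.
by rewrite !val_c // => ->.
Qed.

Lemma colorableE (S : {set T}) k : colorable e S k -> exists c : T -> nat,
  (forall x, x \in S -> c x < k) /\
  (forall x y, x \in S -> y \in S -> e x y -> c x != c y).
Proof.
move=> /existsP[f /andP[/forall_inP H1 /forall_inP H2]].
exists (fun x => f x : nat); split; first exact: H1.
by move=> x y xS yS exy; have /forall_inP/(_ y yS)/implyP/(_ exy) := H2 x xS.
Qed.

Lemma not_colorable0 (S : {set T}) x : x \in S -> ~~ colorable e S 0.
Proof. by move=> xS; apply/negP => /colorableE[c [/(_ x xS)]]. Qed.

Lemma not_colorable1 (S : {set T}) : ~~ edgeless S -> ~~ colorable e S 1.
Proof.
move/edgelessPn => [x [y [xS yS exy]]]; apply/negP => /colorableE[c [H1 H2]].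
have := H2 x y xS yS exy; have := H1 x xS; have := H1 y yS.
by case: (c x) (c y) => [|?] [|?].
Qed.

Definition three_colorable : Prop :=
  exists c : T -> nat, (forall x, c x < 3) /\ (forall x y, e x y -> c x != c y).

Lemma omega_le2 (S : {set T}) : triangle_free e -> omega e S <= 2.
Proof. by move=> tf; apply/bigmax_leqP => K /andP[_ cK]; have := tf K cK; lia. Qed.

Lemma chi_colorable (S : {set T}) : chi e S <= #|T| -> colorable e S (chi e S).
Proof.
move=> h; have hs : has (colorable e S) (iota 0 #|T|.+1).
  by rewrite has_find size_iota ltnS.
by have := nth_find 0 hs; rewrite nth_iota ?add0n // -?/(chi e S) // ltnS.
Qed.

(** Without edges both numbers are 0 or 1; with an edge, triangle-freeness makes [omega] equal to 2
    and the given colouring makes [chi] equal to 2. *)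
Lemma bipartite_perfect (A : {set T}) (c : T -> nat) : triangle_free e ->
  (forall x, x \in A -> c x < 2) -> (forall x y, e x y -> c x != c y) -> perfect e A.
Proof.
move=> tf H1 H2 S /subsetP SA.
have [eS|neS] := boolP (edgeless S).
  rewrite omega_edgeless //.
  have [->|/set0Pn[x xS]] := eqVneq S set0.
    by apply: chi_eq => //; apply: (@colorableI _ _ (fun=> 0)) => // x; rewrite inE.
  apply: chi_eq; first by apply/card_gt0P; exists x.
    by apply: (@colorableI _ _ (fun=> 0)) => // u v uS vS; rewrite (negbTE (edgelessP _ eS u v uS vS)).
  by case=> // _; exact: not_colorable0 xS.
have -> : omega e S = 2 by have := omega_edge neS; have := omega_le2 S tf; lia.
(* [chi] searches only up to [#|T|], so the value 2 needs two vertices. *)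
have cT : 2 <= #|T|.
  move/edgelessPn: (neS) => [x [y [xS yS exy]]].
  have nxy : x != y by apply: contraTneq exy => ->; rewrite e_irr.
  by rewrite -(_ : #|[set x; y]| = 2) ?max_card // cards2 nxy.
apply: chi_eq => //.
  apply: (@colorableI _ _ c) => [|x xS|x y _ _]; [lia | exact: H1 (SA _ xS) | exact: H2].
case=> [_|[|//] _]; last exact: not_colorable1.
by move/edgelessPn: (neS) => [x [y [xS _ _]]]; exact: not_colorable0 xS.
Qed.

(** A good partition of the whole vertex set colours [A] with [chi e A = omega e A <= 2] colours and
    leaves [B] edgeless for the third. Conversely, colours 0 and 1 induce a perfect graph, and the
    third class, being edgeless, falls below [omega e V >= 2]. *)
Theorem perfectly_divisible_3col :
  triangle_free e -> perfectly_divisible e <-> three_colorable.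
Proof.
move=> tf; split=> [pd|[c [H1 H2]] V hV].
  have [eT|neT] := boolP (edgeless [set: T]).
    exists (fun=> 0); split=> // x y exy.
    by move/edgelessP/(_ x y (in_setT _) (in_setT _)): eT; rewrite exy.
  have /edgelessPn/pd [A [B [AB disj pA oB]]] := neT.
  have eB : edgeless B.
    apply: contraT => /omega_edge; have := omega_le2 [set: T] tf; lia.
  have chiA : chi e A <= 2 by rewrite pA ?omega_le2.
  have cT : 2 <= #|T|.
    move/edgelessPn: (neT) => [x [y [xS yS exy]]].
    have nxy : x != y by apply: contraTneq exy => ->; rewrite e_irr.
    by rewrite -(_ : #|[set x; y]| = 2) ?max_card // cards2 nxy.
  have /colorableE[c [c1 c2]] := chi_colorable (leq_trans chiA cT).
  exists (fun x => if x \in A then c x else 2); split=> [x|x y exy].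
    by case: ifP => // /c1; lia.
  have inB z : z \notin A -> z \in B.
    by move=> zA; have := in_setT z; rewrite -AB inE (negbTE zA).
  case: ifPn => xA; case: ifPn => yA.
  - exact: c2.
  - by have := c1 x xA; lia.
  - by have := c1 y yA; lia.
  - by have := edgelessP _ eB x y (inB _ xA) (inB _ yA); rewrite exy.
exists [set x in V | c x < 2], [set x in V | c x == 2]; split.
- apply/setP => x; rewrite !inE -andb_orr.
  by have := H1 x; case: (x \in V) => //= ?; lia.
- rewrite -setI_eq0; apply/eqP/setP => x; rewrite !inE.
  by case: (x \in V) => //=; lia.
- by apply: (@bipartite_perfect _ c) => // x; rewrite inE => /andP[].
- have /omega_edge oV : ~~ edgeless V by apply/edgelessPn.
  rewrite omega_edgeless; first by case: (_ != _); lia.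
  apply/edgelessP => x y; rewrite !inE => /andP[_ /eqP cx] /andP[_ /eqP cy].
  by apply/negP => /H2; rewrite cx cy.
Qed.

End PerfectDivisibility.

(** * Simulation of a multi-stack machine by a Turing machine *)

Section TapeFunction.
Variable M : TM.

Definition tape := Z -> option bool.

Definition tape_upd (A : tape) z v : tape := fun y => if Z.eqb y z then v else A y.

Definition shift (d : move) (z : Z) : Z :=
  match d with MLeft => (z - 1)%Z | MRight => (z + 1)%Z | MStay => z end.

Definition tstep (c : tm_state M * tape * Z) : tm_state M * tape * Z :=
  let: (q, A, z) := c in
  if tm_halt q then c else
  let: (q', w, d) := tm_delta q (A z) in (q', tape_upd A z w, shift d z).

(** Cells missing from the lists are blank, which the default [None] of [nth] reproduces; trailing
    blanks thus make no difference. *)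
Definition represents (c : config M) (a : tm_state M * tape * Z) : Prop :=
  let: (q, A, z) := a in
  [/\ cf_state c = q,
      forall i : nat, nth None (cf_left c) i = A (z - 1 - Z.of_nat i)%Z &
      forall i : nat, nth None (cf_head c :: cf_right c) i = A (z + Z.of_nat i)%Z].

Lemma tape_upd_eq A z v y : y = z -> tape_upd A z v y = v.
Proof. by move=> ->; rewrite /tape_upd Z.eqb_refl. Qed.

Lemma tape_upd_neq A z v y : y <> z -> tape_upd A z v y = A y.
Proof. by move=> /Z.eqb_neq; rewrite /tape_upd => ->. Qed.

Lemma represents_step c a : represents c a -> represents (step c) (tstep a).
Proof.
case: a => [[q A] z]; case: c => q0 l h r /= [-> Hl Hr].
have Ez : A z = h by have := Hr 0; rewrite /= Z.add_0_r.
case: ifP => [hq|_]; first by split.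
rewrite Ez; case: (tm_delta q h) => [[q' w] d].
have Hr' i : nth None r i = A (z + 1 + Z.of_nat i)%Z.
  by have := Hr i.+1; rewrite /= => ->; congr A; lia.
have Hl' a l' : l = a :: l' ->
    a = A (z - 1)%Z /\ forall i, nth None l' i = A (z - 1 - 1 - Z.of_nat i)%Z.
  move=> E; split; first by have := Hl 0; rewrite E /= => ->; congr A; lia.
  by move=> i; have := Hl i.+1; rewrite E /= => ->; congr A; lia.
have Hr'' a r' : r = a :: r' ->
    a = A (z + 1)%Z /\ forall i, nth None r' i = A (z + 1 + 1 + Z.of_nat i)%Z.
  move=> E; split; first by have := Hr' 0; rewrite E /= => ->; congr A; lia.
  by move=> i; have := Hr' i.+1; rewrite E /= => ->; congr A; lia.
case: d => /=.
- case: l Hl Hl' => [|a l'] Hl Hl' /=; split=> //.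
  + move=> i; rewrite tape_upd_neq; last lia.
    by have := Hl i.+1; rewrite !nth_nil => ->; congr A; lia.
  + case=> [|[|i]] /=.
    * rewrite tape_upd_neq; last lia.
      by have := Hl 0; rewrite /= => ->; congr A; lia.
    * by rewrite tape_upd_eq //; lia.
    * by rewrite Hr' tape_upd_neq; [congr A; lia | lia].
  + have [Ea Hl2] := Hl' a l' erefl.
    by move=> i; rewrite Hl2 tape_upd_neq //; lia.
  + have [Ea Hl2] := Hl' a l' erefl.
    case=> [|[|i]] /=.
    * by rewrite tape_upd_neq ?Ea; [congr A; lia | lia].
    * by rewrite tape_upd_eq //; lia.
    * by rewrite Hr' tape_upd_neq; [congr A; lia | lia].
- case: r Hr Hr' Hr'' => [|a r'] Hr Hr' Hr'' /=; split=> //.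
  + case=> [|i] /=; first by rewrite tape_upd_eq //; lia.
    by rewrite Hl tape_upd_neq; [congr A; lia | lia].
  + move=> i; have -> : nth None [:: None] i = @None bool by case: i => [|[|i]].
    rewrite tape_upd_neq; last lia.
    by have := Hr' i; rewrite nth_nil => ->; congr A; lia.
  + case=> [|i] /=; first by rewrite tape_upd_eq //; lia.
    by rewrite Hl tape_upd_neq; [congr A; lia | lia].
  + have [Ea Hr2] := Hr'' a r' erefl.
    case=> [|i] /=.
    * by rewrite tape_upd_neq ?Ea; [congr A; lia | lia].
    * by rewrite Hr2 tape_upd_neq; [congr A; lia | lia].
- split=> //.
  + by move=> i; rewrite Hl tape_upd_neq //; lia.
  + case=> [|i] /=; first by rewrite tape_upd_eq //; lia.
    by rewrite Hr' tape_upd_neq; [congr A; lia | lia].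
Qed.

Lemma represents_run t c a : represents c a -> represents (run t c) (iter t tstep a).
Proof. by move=> H; elim: t => //= t IH; apply: represents_step. Qed.

End TapeFunction.

Lemma read_block_nth s w :
  (forall i, nth None s i = nth None (map Some w) i) -> read_block s = w.
Proof.
elim: w s => [|b w IH] s H.
  by case: s H => //= a s H; have := H 0 => /= ->.
case: s H => [|a s] H; first by have := H 0.
have /= -> := H 0; congr cons; apply: IH => i; exact: (H i.+1).
Qed.

(** * A machine with several stacks, and its stacks on a single tape *)

Inductive instr := IPush of nat & bool | IPop of nat & nat & nat & nat | IJmp of nat.

Definition store := nat -> seq bool.

Definition store_upd (st : store) s l : store := fun r => if r == s then l else st r.

Definition fstep (code : seq instr) (c : nat * store) : nat * store :=
  let: (pc, st) := c in
  match onth code pc with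
  | None => c
  | Some (IPush s b) => (pc.+1, store_upd st s (b :: st s))
  | Some (IPop s jn jt jf) =>
      match st s with
      | [::] => (jn, st)
      | b :: l => (if b then jt else jf, store_upd st s l)
      end
  | Some (IJmp j) => (j, st)
  end.

Section Simulation.
Variables (code : seq instr) (K : nat).
Hypothesis K_gt0 : 0 < K.

Definition instr_ok (i : instr) : bool :=
  match i with
  | IPush s _ => s <= K
  | IPop s jn jt jf => [&& s <= K, jn <= size code, jt <= size code & jf <= size code]
  | IJmp j => j <= size code
  end.
Hypothesis code_ok : all instr_ok code.

(* Stack 0 occupies the cells 0, 1, 2, ... and the stacks 1..K are interleaved
   on the left half of the tape, leaving the cells -K..-1 blank: the cell that
   precedes the bottom of any stack (its [floor]) is therefore always blank,
   which is how the head finds its way back. *)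
Definition stride (s : nat) : Z := if s == 0 then 1%Z else (- Z.of_nat K)%Z.
Definition floor (s : nat) : Z := if s == 0 then (-1)%Z else (- Z.of_nat s)%Z.
Definition addr (s p : nat) : Z := (floor s + stride s * Z.of_nat p.+1)%Z.

Definition holds (st : store) (A : tape) : Prop :=
  (forall s p, s <= K -> A (addr s p) = nth None (map Some (rev (st s))) p) /\
  (forall s, s <= K -> A (floor s) = None).

Lemma addrS s p : addr s p.+1 = (addr s p + stride s)%Z.
Proof. rewrite /addr; lia. Qed.

Lemma addr0 s : addr s 0 = (floor s + stride s)%Z.
Proof. rewrite /addr; lia. Qed.

(** Stack 0 has the nonnegative cells. For the others the cell is [-(s + K * (p + 1))] with [s]
    between 1 and [K], which determines both [s] and [p]. *)
Lemma addr_inj s p s' p' : s <= K -> s' <= K -> addr s p = addr s' p' -> s = s' /\ p = p'.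
Proof.
rewrite /addr /floor /stride => hs hs'.
case: eqP => hs0; case: eqP => hs0'; [lia | nia | nia |].
move=> E.
have : p < p' \/ p' < p \/ p = p' by lia.
case=> [|[|]]; nia.
Qed.

Lemma addr_floor s p s' : s <= K -> s' <= K -> addr s p <> floor s'.
Proof.
rewrite /addr /floor /stride => hs hs'.
case: eqP => hs0; case: eqP => hs0'; nia.
Qed.

(** [Fetch] decodes an instruction at cell 0, [Seek] climbs to the first free cell of the stack,
    [Test] looks at the place just below it, and [Back] descends to the floor and returns to cell 0.
    The program counter may equal [size code], which means halting. *)
Definition phase : finType :=
  ('I_(size code).+1 + 'I_(size code).+1 + 'I_(size code).+1 +
   'I_(size code).+1 * 'I_K.+1)%type.
Definition Fetch pc : phase := inl (inl (inl (inord pc))).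
Definition Seek pc : phase := inl (inl (inr (inord pc))).
Definition Test pc : phase := inl (inr (inord pc)).
Definition Back pc s : phase := inr (inord pc, inord s).

(* A state carries a number of pending unit moves in a given direction
   ([true] is right), performed before its phase acts. *)
Definition simstate : finType := (phase * (bool * 'I_(K + K).+2))%type.
Definition St (c : phase) (d : bool) (m : nat) : simstate := (c, (d, inord m)).

Definition out_dir (s : nat) : bool := s == 0.
Definition stride_len (s : nat) : nat := if s == 0 then 1 else K.
Definition go_len (s : nat) : nat := if s == 0 then 0 else K + s.
Definition home_len (s : nat) : nat := if s == 0 then 1 else s.

(** A pop overshoots to the free cell and steps back by one stride: a blank found there is the
    floor, so the stack was empty. *)
Definition core_delta (c : phase) (h : option bool) : simstate * option bool :=
  match c with
  | inl (inl (inl pc)) =>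
      match onth code pc with
      | Some (IPush s _) | Some (IPop s _ _ _) => (St (Seek pc) false (go_len s), h)
      | Some (IJmp j) => (St (Fetch j) false 0, h)
      | None => (St c false 0, h)
      end
  | inl (inl (inr pc)) =>
      match onth code pc with
      | Some (IPush s b) =>
          if h is Some _ then (St (Seek pc) (out_dir s) (stride_len s), h)
          else (St (Back pc.+1 s) false 0, Some b)
      | Some (IPop s _ _ _) =>
          if h is Some _ then (St (Seek pc) (out_dir s) (stride_len s), h)
          else (St (Test pc) (~~ out_dir s) (stride_len s), None)
      | _ => (St c false 0, h)
      end
  | inl (inr pc) =>
      match onth code pc with
      | Some (IPop s jn jt jf) =>
          if h is Some b
          then (St (Back (if b then jt else jf) s) (~~ out_dir s) (stride_len s), None)
          else (St (Fetch jn) true (home_len s), None)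
      | _ => (St c false 0, h)
      end
  | inr (pc, s) =>
      if h is Some _ then (St c (~~ out_dir s) (stride_len s), h)
      else (St (Fetch pc) true (home_len s), None)
  end.

Definition sim_delta (q : simstate) (h : option bool) : simstate * option bool * move :=
  let: (c, (d, m)) := q in
  if val m is m'.+1 then (St c d m', h, if d then MRight else MLeft)
  else (core_delta c h, MStay).

Definition sim_halt (q : simstate) : bool :=
  let: (c, (_, m)) := q in
  (val m == 0) && (if c is inl (inl (inl pc)) then val pc == size code else false).

Definition simTM : TM :=
  {| tm_state := simstate; tm_start := St (Fetch 0) false 0;
     tm_halt := sim_halt; tm_accept := sim_halt; tm_delta := sim_delta |}.

Lemma Seek_nohalt pc d m : ~~ sim_halt (St (Seek pc) d m).
Proof. by rewrite /sim_halt /= andbF. Qed.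

Lemma Test_nohalt pc d m : ~~ sim_halt (St (Test pc) d m).
Proof. by rewrite /sim_halt /= andbF. Qed.

Lemma Back_nohalt pc s d m : ~~ sim_halt (St (Back pc s) d m).
Proof. by rewrite /sim_halt /= andbF. Qed.

#[local] Hint Resolve Seek_nohalt Test_nohalt Back_nohalt : core.

Definition reach (n : nat) (a b : simstate * tape * Z) := iter n (@tstep simTM) a = b.

Lemma reach_trans n m a b c : reach n a b -> reach m b c -> reach (n + m) a c.
Proof. by rewrite /reach addnC iterD => -> ->. Qed.

Lemma reach1 c d A z :
  ~~ sim_halt (St c d 0) ->
  reach 1 (St c d 0, A, z) ((core_delta c (A z)).1, tape_upd A z (core_delta c (A z)).2, z).
Proof.
move=> h; change (@tstep simTM (St c d 0, A, z) =
  ((core_delta c (A z)).1, tape_upd A z (core_delta c (A z)).2, z)).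
rewrite /tstep; have -> : @tm_halt simTM (St c d 0) = false by exact: negbTE.
have -> : @tm_delta simTM (St c d 0) (A z) = (core_delta c (A z), MStay) by rewrite /= inordK.
by case: (core_delta c (A z)).
Qed.

Definition offset (d : bool) (m : nat) : Z := if d then Z.of_nat m else (- Z.of_nat m)%Z.

Lemma reach_move c d m A z :
  m <= (K + K).+1 ->
  reach m (St c d m, A, z) (St c d 0, A, (z + offset d m)%Z).
Proof.
elim: m z => [|m IH] z hm.
  by rewrite /reach /offset /=; congr (_, _, _); case: (d) => /=; lia.
rewrite /reach iterSr.
have -> : @tstep simTM (St c d m.+1, A, z) = (St c d m, A, (z + offset d 1)%Z).
  rewrite /= /sim_halt /= inordK //=; congr (_, _, _).
    by apply: functional_extensionality => y; rewrite /tape_upd; case: Z.eqb_spec => // ->.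
  by rewrite /offset; case: (d) => /=; lia.
rewrite -/(reach m _ _).
have -> : (z + offset d m.+1)%Z = ((z + offset d 1) + offset d m)%Z
  by rewrite /offset; case: (d) => /=; lia.
by apply: IH; lia.
Qed.

Lemma tape_upd_id A z : tape_upd A z (A z) = A.
Proof. by apply: functional_extensionality => y; rewrite /tape_upd; case: Z.eqb_spec => // ->. Qed.

Lemma reach_act c d A z c' d' m w :
  ~~ sim_halt (St c d 0) -> core_delta c (A z) = (St c' d' m, w) -> m <= (K + K).+1 ->
  reach m.+1 (St c d 0, A, z) (St c' d' 0, tape_upd A z w, (z + offset d' m)%Z).
Proof.
move=> h E hm; rewrite -add1n; apply: reach_trans (reach_move _ _ _ _ hm).
by have := @reach1 c d A z h; rewrite E.
Qed.

Lemma reach_keep c d A z c' d' m :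
  ~~ sim_halt (St c d 0) -> core_delta c (A z) = (St c' d' m, A z) -> m <= (K + K).+1 ->
  reach m.+1 (St c d 0, A, z) (St c' d' 0, A, (z + offset d' m)%Z).
Proof. by move=> h E hm; rewrite -{2}(tape_upd_id A z); exact: reach_act. Qed.

Definition uses_stack (pc s : nat) : bool :=
  match onth code pc with
  | Some (IPush r _) | Some (IPop r _ _ _) => r == s
  | _ => false
  end.

Lemma onth_ltn pc i : onth code pc = Some i -> pc < size code.
Proof. by move=> E; rewrite -onthTE E. Qed.

Lemma instr_at_ok pc i : onth code pc = Some i -> instr_ok i.
Proof.
move=> E; have /(all_nthP (IJmp 0)) /(_ pc (onth_ltn E)) := code_ok.
by rewrite (onth_nth (IJmp 0) i code pc E).
Qed.

Lemma uses_stack_bounds pc s : uses_stack pc s -> pc < size code /\ s <= K.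
Proof.
rewrite /uses_stack; case E: (onth code pc) => [i|] // H.
split; first exact: onth_ltn E.
have := instr_at_ok E; case: {E} i H => [r b|r jn jt jf|] //= /eqP -> //.
by case/and4P.
Qed.

Lemma seek_some pc s b : uses_stack pc s ->
  core_delta (Seek pc) (Some b) = (St (Seek pc) (out_dir s) (stride_len s), Some b).
Proof.
move=> H; have [lt _] := uses_stack_bounds H.
rewrite /= inordK; last exact: ltnW.
by move: H; rewrite /uses_stack; case: onth => [[r c|r jn jt jf|]|] //= /eqP ->.
Qed.

Lemma out_step s : offset (out_dir s) (stride_len s) = stride s.
Proof. by rewrite /offset /out_dir /stride_len /stride; case: eqP. Qed.

Lemma in_step s : offset (~~ out_dir s) (stride_len s) = (- stride s)%Z.
Proof. by rewrite /offset /out_dir /stride_len /stride; case: eqP => //=; lia. Qed.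

Lemma home_step s : (floor s + offset true (home_len s))%Z = 0%Z.
Proof. by rewrite /offset /home_len /floor; case: eqP => //=; lia. Qed.

Lemma go_step s : (0 + offset false (go_len s))%Z = addr s 0.
Proof. by rewrite /offset /go_len addr0 /floor /stride; case: eqP => //=; lia. Qed.

Lemma stride_len_bound s : stride_len s <= K.
Proof. by rewrite /stride_len; case: eqP. Qed.

Lemma go_len_bound s : s <= K -> go_len s <= K + K.
Proof. by rewrite /go_len; case: eqP => //; lia. Qed.

Lemma home_len_bound s : s <= K -> home_len s <= K.
Proof. by rewrite /home_len; case: eqP => //; lia. Qed.

Lemma holds_some st A s p : holds st A -> s <= K -> p < size (st s) ->
  exists b, A (addr s p) = Some b.
Proof.
move=> [H _] hs hp; rewrite H // (nth_map true) ?size_rev //.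
by eexists.
Qed.

Lemma holds_none st A s : holds st A -> s <= K -> A (addr s (size (st s))) = None.
Proof. by move=> [H _] hs; rewrite H // nth_default // size_map size_rev. Qed.

Lemma seek_top pc s st A d : uses_stack pc s -> holds st A ->
  exists d', reach (size (st s) * (stride_len s).+1)
    (St (Seek pc) d 0, A, addr s 0) (St (Seek pc) d' 0, A, addr s (size (st s))).
Proof.
move=> U H; have [lt hs] := uses_stack_bounds U.
have : size (st s) <= size (st s) by [].
elim: {1 3 4}(size (st s)) => [|p IH] hp; first by exists d.
have [d1 R1] := IH (ltnW hp); exists (out_dir s).
rewrite mulSn addnC; apply: reach_trans R1 _.
rewrite addrS -out_step; apply: reach_keep => //; last first.
  by have := stride_len_bound s; lia.
by have [b ->] := holds_some H hs hp; exact: seek_some.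
Qed.

(** Height [q] is the place of entry [q - 1], and height 0 is the floor, whose blank ends the
    descent. *)
Lemma back_home pc s A d q :
  pc <= size code -> s <= K -> A (floor s) = None ->
  (forall p, p < q -> exists b, A (addr s p) = Some b) ->
  exists d', reach (q * (stride_len s).+1 + (home_len s).+1)
    (St (Back pc s) d 0, A, (floor s + stride s * Z.of_nat q)%Z)
    (St (Fetch pc) d' 0, A, 0%Z).
Proof.
move=> hpc hs Hf; elim: q d => [|q IH] d Hq.
  exists true; rewrite mul0n add0n.
  have -> : (floor s + stride s * Z.of_nat 0)%Z = floor s by lia.
  rewrite -[in X in reach _ _ X](home_step s); apply: reach_keep => //.
    by rewrite Hf /= !inordK.
  by have := home_len_bound hs; lia.
have [d' R] := IH (~~ out_dir s) (fun p h => Hq p (ltnW h)).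
exists d'; rewrite mulSn -addnA; apply: reach_trans R.
have -> : (floor s + stride s * Z.of_nat q)%Z =
          (floor s + stride s * Z.of_nat q.+1 + offset (~~ out_dir s) (stride_len s))%Z.
  by rewrite in_step; lia.
apply: reach_keep => //; last by have := stride_len_bound s; lia.
by have [b] := Hq q (ltnSn q); rewrite /addr => -> /=; rewrite inordK.
Qed.

Lemma holds_upd st A s l p v : s <= K -> holds st A ->
  (forall p', p' != p -> nth None (map Some (rev l)) p' = nth None (map Some (rev (st s))) p') ->
  nth None (map Some (rev l)) p = v ->
  holds (store_upd st s l) (tape_upd A (addr s p) v).
Proof.
move=> hs [H1 H2] Hp Hv; split=> [s' p' hs'|s' hs']; last first.
  by rewrite tape_upd_neq ?H2 //; apply/nesym; exact: addr_floor.
rewrite /store_upd; case: eqP => [->|ne].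
  have [->|nep] := eqVneq p' p; first by rewrite tape_upd_eq.
  rewrite tape_upd_neq ?H1 ?Hp //.
  by case/addr_inj => // _ /eqP; rewrite (negbTE nep).
by rewrite tape_upd_neq ?H1 //; case/addr_inj.
Qed.

(** An instruction crosses its stack at most once in each direction, by strides of at most [K] moves
    and one action; the factor 10 also covers the trips from and to cell 0. *)
Definition instr_cost := 10 * K.+1.

Lemma sim_instr st A d pc pc' st' H :
  holds st A -> pc < size code -> (forall s, size (st s) <= H) ->
  fstep code (pc, st) = (pc', st') ->
  exists n d' A', [/\ n <= instr_cost * H.+1, holds st' A', pc' <= size code &
    reach n (St (Fetch pc) d 0, A, 0%Z) (St (Fetch pc') d' 0, A', 0%Z)].
Proof.
move=> HA lt hH; rewrite /fstep.
have nh : ~~ sim_halt (St (Fetch pc) d 0).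
  by rewrite /sim_halt /= inordK //= inordK ?neq_ltn ?lt // ltnW.
case E: (onth code pc) => [i|]; last by move: lt; rewrite -onthTE E.
have okE := instr_at_ok E.
have go s : uses_stack pc s ->
    exists d', reach ((go_len s).+1 + size (st s) * (stride_len s).+1)
      (St (Fetch pc) d 0, A, 0%Z) (St (Seek pc) d' 0, A, addr s (size (st s))).
  move=> U; have [_ hs] := uses_stack_bounds U.
  have [d' R] := @seek_top pc s st A false U HA; exists d'.
  apply: reach_trans R; rewrite -go_step; apply: reach_keep => //.
    rewrite /= inordK; last exact: ltnW.
    by move: U; rewrite /uses_stack; case: onth => [[r c|r jn jt jf|]|] //= /eqP ->.
  by have := go_len_bound hs; lia.
case: i E okE => [s b|s jn jt jf|j] E okE.
- case=> <- <-.
  have U : uses_stack pc s by rewrite /uses_stack E.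
  have [_ hs] := uses_stack_bounds U.
  have [d1 R1] := go s U.
  set A' := tape_upd A (addr s (size (st s))) (Some b).
  have HA' : holds (store_upd st s (b :: st s)) A'.
    apply: holds_upd => //.
      move=> p' hp'; rewrite rev_cons map_rcons nth_rcons size_map size_rev.
      case: ltnP => // h; rewrite (negbTE hp') nth_default //.
      by rewrite size_map size_rev.
    by rewrite rev_cons map_rcons nth_rcons size_map size_rev ltnn eqxx.
  have [|p hp|d2 R2] := @back_home pc.+1 s A' false (size (st s)).+1 lt hs.
  + by case: HA' => _; apply.
  + apply: (holds_some HA' hs); by rewrite /store_upd eqxx.
  exists ((go_len s).+1 + size (st s) * (stride_len s).+1 +
          (1 + ((size (st s)).+1 * (stride_len s).+1 + (home_len s).+1))), d2, A'.
  split=> //.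
    have := hH s; have := go_len_bound hs; have := home_len_bound hs.
    have := stride_len_bound s; rewrite /instr_cost; nia.
  apply: reach_trans R1 _; apply: reach_trans R2.
  rewrite -/(addr s (size (st s))).
  have := @reach_act (Seek pc) d1 A (addr s (size (st s))) (Back pc.+1 s) false 0 (Some b).
  rewrite Z.add_0_r; apply=> //.
  rewrite holds_none //= inordK ?E //; exact: ltnW.
- have U : uses_stack pc s by rewrite /uses_stack E.
  have [_ hs] := uses_stack_bounds U.
  have [d1 R1] := go s U.
  move: okE => /= /and4P[_ hjn hjt hjf].
  have R2 : reach (stride_len s).+1 (St (Seek pc) d1 0, A, addr s (size (st s)))
      (St (Test pc) (~~ out_dir s) 0, A, (addr s (size (st s)) - stride s)%Z).
    rewrite -Z.add_opp_r -in_step; apply: reach_keep => //; last first.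
      by have := stride_len_bound s; lia.
    rewrite holds_none //= inordK ?E //; exact: ltnW.
  case Es: (st s) => [|b l] [<- <-].
    exists ((go_len s).+1 + size (st s) * (stride_len s).+1 +
       ((stride_len s).+1 + (home_len s).+1)), true, A; split=> //.
      have := hH s; have := go_len_bound hs; have := home_len_bound hs.
      have := stride_len_bound s; rewrite /instr_cost; nia.
    apply: reach_trans R1 _; apply: reach_trans R2 _.
    rewrite Es /= addr0 Z.add_simpl_r -[in X in reach _ _ X](home_step s).
    have Hf : A (floor s) = None by case: HA => _; apply.
    apply: reach_keep => //; last by have := home_len_bound hs; lia.
    rewrite Hf /= inordK ?E //; exact: ltnW.
  set A' := tape_upd A (addr s (size l)) None.
  have HA' : holds (store_upd st s l) A'.
    apply: holds_upd => //.
      move=> p' hp'; rewrite Es rev_cons map_rcons nth_rcons size_map size_rev.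
      case: ltnP => // h; rewrite (negbTE hp') nth_default //.
      by rewrite size_map size_rev.
    by rewrite nth_default // size_map size_rev.
  have hj : (if b then jt else jf) <= size code by case: (b).
  have [|p hp|d2 R3] := @back_home (if b then jt else jf) s A' (~~ out_dir s) (size l) hj hs.
  + by case: HA' => _; apply.
  + apply: (holds_some HA' hs); by rewrite /store_upd eqxx.
  exists ((go_len s).+1 + size (st s) * (stride_len s).+1 +
     ((stride_len s).+1 + ((stride_len s).+1 + (size l * (stride_len s).+1 + (home_len s).+1)))),
     d2, A'.
  split=> //.
    have := hH s; have := go_len_bound hs; have := home_len_bound hs.
    have := stride_len_bound s; rewrite Es /instr_cost /=; nia.
  apply: reach_trans R1 _; apply: reach_trans R2 _; apply: reach_trans R3.
  rewrite Es /= addrS Z.add_simpl_r.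
  have -> : (floor s + stride s * Z.of_nat (size l))%Z =
      (addr s (size l) + offset (~~ out_dir s) (stride_len s))%Z.
    by rewrite in_step /addr; lia.
  apply: reach_act => //; last by have := stride_len_bound s; lia.
  case: HA => H1 _; rewrite H1 // Es rev_cons map_rcons nth_rcons size_map size_rev ltnn eqxx.
  rewrite /= inordK ?E //; exact: ltnW.
- case=> <- <-; exists 1, false, A; split=> //.
  have := @reach_keep (Fetch pc) d A 0%Z (Fetch j) false 0.
  rewrite Z.add_0_r; apply=> //.
  rewrite /= inordK ?E //; exact: ltnW.
Qed.

Lemma fstep_size c H :
  (forall s, size (c.2 s) <= H) -> forall s, size ((fstep code c).2 s) <= H.+1.
Proof.
case: c => pc st /= hH s.
have hS := leq_trans (hH s) (leqnSn H).
case: onth => [[r b|r jn jt jf|j]|] //=.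
  by rewrite /store_upd; case: eqP => //= _; exact: hH.
case E: (st r) => [|b l] //=; rewrite /store_upd; case: eqP => //= _.
by have := hH r; rewrite E /=; lia.
Qed.

(** An instruction raises a stack by at most one, so [H + n] bounds all heights during [n] steps. *)
Lemma sim_run n st A d H pc st' :
  holds st A -> pc <= size code -> (forall s, size (st s) <= H) ->
  iter n (fstep code) (pc, st) = (size code, st') ->
  exists m d' A', [/\ m <= n * (instr_cost * (H + n).+1), holds st' A' &
    reach m (St (Fetch pc) d 0, A, 0%Z) (St (Fetch (size code)) d' 0, A', 0%Z)].
Proof.
elim: n st A d H pc => [|n IH] st A d H pc HA hpc hH.
  by case=> -> <-; exists 0, d, A.
(* The stack machine idles at the end of its code while [n] keeps counting; the Turing machine has
   then already halted. *)
have halts : pc = size code ->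
    iter n.+1 (fstep code) (pc, st) = (size code, st') -> st' = st.
  move=> ->; have fix_end : fstep code (size code, st) = (size code, st).
    by rewrite /= onth_default.
  have -> : iter n.+1 (fstep code) (size code, st) = (size code, st).
    by elim: (n.+1) => //= k ->.
  by case.
rewrite leq_eqVlt in hpc; case/orP: hpc => [/eqP epc|ltpc].
  by move=> /(halts epc) ->; exists 0, d, A; rewrite epc.
rewrite iterSr; case E: (fstep code (pc, st)) => [pc1 st1] R.
have [m [d1 [A1 [hm HA1 hpc1 R1]]]] := sim_instr d HA ltpc hH E.
have hH1 s : size (st1 s) <= H.+1 by have := @fstep_size (pc, st) H hH s; rewrite E.
have [m' [d2 [A2 [hm' HA2 R2]]]] := IH _ _ d1 _ _ HA1 hpc1 hH1 R.
exists (m + m'), d2, A2; split=> //; last exact: reach_trans R1 R2.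
rewrite mulSn leq_add //.
  by apply: leq_trans hm _; rewrite leq_mul2l; apply/orP; right; lia.
by rewrite addSn addnS in hm' *.
Qed.

(** The head of a list is the top of the stack, while the first input symbol is in cell 0, the
    bottom: hence the reversal. *)
Definition init_store (x : seq bool) : store := store_upd (fun=> [::]) 0 (rev x).

Definition init_tape (x : seq bool) : tape :=
  fun z => if (z <? 0)%Z then None else nth None (map Some x) (Z.to_nat z).

Lemma holds_init x : holds (init_store x) (init_tape x).
Proof.
rewrite /init_tape /init_store; split=> [s p hs|s hs]; last first.
  by rewrite /floor; case: eqP => // hs0; case: Z.ltb_spec => // h; exfalso; lia.
rewrite /store_upd; case: eqP => [->|hs0].
  rewrite revK /addr /floor /stride eqxx; case: Z.ltb_spec => [h|_]; first by exfalso; lia.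
  by congr nth; lia.
rewrite nth_nil /addr /floor /stride; case: eqP => // _.
by case: Z.ltb_spec => // h; exfalso; nia.
Qed.

Lemma represents_init x :
  @represents simTM (init simTM x) (St (Fetch 0) false 0, init_tape x, 0%Z).
Proof.
rewrite /init_tape; split.
- by case: x.
- move=> i; case: Z.ltb_spec => [_|h]; last by exfalso; lia.
  by case: x => [|b x] /=; rewrite nth_nil.
- move=> i; case: Z.ltb_spec => [h|_]; first by exfalso; lia.
  have -> : Z.to_nat (0 + Z.of_nat i) = i by lia.
  by case: x => [|b x] //; case: i => [|[|i]].
Qed.

Lemma simTM_computes n x st' :
  iter n (fstep code) (0, init_store x) = (size code, st') ->
  exists t, t <= n * (instr_cost * (size x + n).+1) /\
    let c := run t (init simTM x) in halted c /\ output c = rev (st' 0).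
Proof.
move=> R.
have hH s : size (init_store x s) <= size x.
  by rewrite /init_store /store_upd; case: eqP => //= _; rewrite size_rev.
have [m [d [A [hm HA Rm]]]] := sim_run false (holds_init x) (leq0n _) hH R.
exists m; split=> //=.
have := represents_run m (represents_init x); rewrite Rm.
case: (run m _) => q l h r /= [-> _ Hr]; split.
  by rewrite /halted /= inordK //= inordK.
apply: read_block_nth => i; case: HA => HA _.
by rewrite Hr -HA //; congr A; rewrite /addr /floor /stride eqxx; lia.
Qed.

End Simulation.

(** * Structured stack programs *)

Inductive cmd :=
| Skip
| Push of nat & bool
| Seq of cmd & cmd
| Pop of nat & cmd & cmd & cmd
| Loop of nat & cmd & cmd.

(* The last argument counts the executed instructions of the compiled code. *)
Inductive exec : cmd -> store -> store -> nat -> Prop :=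
| ExSkip st : exec Skip st st 0
| ExPush s b st : exec (Push s b) st (store_upd st s (b :: st s)) 1
| ExSeq c1 c2 st1 st2 st3 n1 n2 :
    exec c1 st1 st2 n1 -> exec c2 st2 st3 n2 -> exec (Seq c1 c2) st1 st3 (n1 + n2)
| ExPopN s cn ct cf st st' n :
    st s = [::] -> exec cn st st' n -> exec (Pop s cn ct cf) st st' n.+2
| ExPopC s cn ct cf st b l st' n :
    st s = b :: l -> exec (if b then ct else cf) (store_upd st s l) st' n ->
    exec (Pop s cn ct cf) st st' n.+2
| ExLoopN s ct cf st : st s = [::] -> exec (Loop s ct cf) st st 1
| ExLoopC s ct cf st b l st1 st2 n1 n2 :
    st s = b :: l -> exec (if b then ct else cf) (store_upd st s l) st1 n1 ->
    exec (Loop s ct cf) st1 st2 n2 -> exec (Loop s ct cf) st st2 (n1 + n2).+2.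

Fixpoint csize (c : cmd) : nat :=
  match c with
  | Skip => 0
  | Push _ _ => 1
  | Seq c1 c2 => csize c1 + csize c2
  | Pop _ cn ct cf => (csize cn + csize ct + csize cf).+4
  | Loop _ ct cf => (csize ct + csize cf).+3
  end.

(** Jump targets are absolute, hence the offset [o]. The last branch of [Pop] also ends with a jump,
    to the next instruction, so that every branch costs two steps besides its body. *)
Fixpoint comp (o : nat) (c : cmd) : seq instr :=
  match c with
  | Skip => [::]
  | Push s b => [:: IPush s b]
  | Seq c1 c2 => comp o c1 ++ comp (o + csize c1) c2
  | Pop s cn ct cf =>
      let ot := o.+1 + (csize cn).+1 in
      let o2 := ot + (csize ct).+1 in
      let e := o2 + (csize cf).+1 in
      IPop s o.+1 ot o2 :: comp o.+1 cn ++ IJmp e :: comp ot ct ++ IJmp e ::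
        comp o2 cf ++ [:: IJmp e]
  | Loop s ct cf =>
      let o2 := o.+1 + (csize ct).+1 in
      let e := o2 + (csize cf).+1 in
      IPop s e o.+1 o2 :: comp o.+1 ct ++ IJmp o :: comp o2 cf ++ [:: IJmp o]
  end.

Fixpoint max_stack (c : cmd) : nat :=
  match c with
  | Skip => 0
  | Push s _ => s
  | Seq c1 c2 => maxn (max_stack c1) (max_stack c2)
  | Pop s cn ct cf => maxn s (maxn (max_stack cn) (maxn (max_stack ct) (max_stack cf)))
  | Loop s ct cf => maxn s (maxn (max_stack ct) (max_stack cf))
  end.

Lemma size_comp c o : size (comp o c) = csize c.
Proof.
elim: c o => //= [c1 IH1 c2 IH2|s cn IHn ct IHt cf IHf|s ct IHt cf IHf] o.
- by rewrite size_cat IH1 IH2.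
- by rewrite !(size_cat, IHn, IHt, IHf) /= !(size_cat, IHn, IHt, IHf) /= size_cat IHf /=; lia.
- by rewrite !(size_cat, IHt, IHf) /= !(size_cat, IHt, IHf) /=; lia.
Qed.

Lemma comp_ok code K c o : max_stack c <= K -> o + csize c <= size code ->
  all (instr_ok code K) (comp o c).
Proof.
elim: c o => //= [s b|c1 IH1 c2 IH2|s cn IHn ct IHt cf IHf|s ct IHt cf IHf] o.
- by rewrite andbT.
- by rewrite geq_max all_cat => /andP[h1 h2] h; rewrite IH1 ?IH2 //; lia.
- rewrite !geq_max => /and4P[hs hn ht hf] h.
  rewrite all_cat /= all_cat /= all_cat /= IHn ?IHt ?IHf //; lia.
- rewrite !geq_max => /and3P[hs ht hf] h.
  rewrite all_cat /= all_cat /= IHt ?IHf //; lia.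
Qed.

Definition code_at (code : seq instr) (o : nat) (l : seq instr) : Prop :=
  forall i, i < size l -> onth code (o + i) = onth l i.

Lemma code_at_cat code o l1 l2 :
  code_at code o (l1 ++ l2) -> code_at code o l1 /\ code_at code (o + size l1) l2.
Proof.
move=> H; split=> i hi.
  by rewrite H ?size_cat ?onth_cat ?hi //; lia.
rewrite -addnA H ?size_cat ?ltn_add2l // onth_cat ltnNge leq_addr /=.
by congr onth; lia.
Qed.

Lemma code_at_cons code o i l :
  code_at code o (i :: l) -> onth code o = Some i /\ code_at code o.+1 l.
Proof.
move=> H; split; first by have := H 0 isT; rewrite addn0.
by move=> j hj; rewrite addSnnS H.
Qed.

Section FlatSteps.
Variables (code : seq instr) (pc : nat) (st : store).

Lemma fstep_jmp j : onth code pc = Some (IJmp j) -> fstep code (pc, st) = (j, st).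
Proof. by move=> E; rewrite /fstep E. Qed.

Lemma fstep_pop_nil s jn jt jf : onth code pc = Some (IPop s jn jt jf) -> st s = [::] ->
  fstep code (pc, st) = (jn, st).
Proof. by move=> E Es; rewrite /fstep E Es. Qed.

Lemma fstep_pop_cons s jn jt jf b l :
  onth code pc = Some (IPop s jn jt jf) -> st s = b :: l ->
  fstep code (pc, st) = (if b then jt else jf, store_upd st s l).
Proof. by move=> E Es; rewrite /fstep E Es. Qed.

End FlatSteps.

Lemma comp_correct code c st st' n o :
  exec c st st' n -> code_at code o (comp o c) ->
  iter n (fstep code) (o, st) = (o + csize c, st').
Proof.
move=> E; elim: E o => {c st st' n}.
- by move=> st o _; rewrite addn0.
- by move=> s b st o /= /code_at_cons[E _]; rewrite E addn1.
- move=> c1 c2 st1 st2 st3 n1 n2 _ IH1 _ IH2 o /= /code_at_cat[H1 H2].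
  rewrite addnC iterD IH1 //; rewrite size_comp in H2.
  by rewrite (IH2 _ H2) addnA.
- move=> s cn ct cf st st' n Es _ IH o /code_at_cons[E /code_at_cat[H1]].
  rewrite size_comp => /code_at_cons[Ej _].
  rewrite iterS iterSr (fstep_pop_nil E Es) IH // (fstep_jmp _ Ej) /=; congr pair; lia.
- move=> s cn ct cf st b l st' n Es _ IH o /code_at_cons[E /code_at_cat[_]].
  rewrite size_comp => /code_at_cons[_ /code_at_cat[H2]].
  rewrite size_comp => /code_at_cons[Ej2 /code_at_cat[H3]].
  rewrite size_comp => /code_at_cons[Ej3 _].
  rewrite iterS iterSr (fstep_pop_cons E Es).
  case: b IH Es => IH Es.
    rewrite addnS IH; last by rewrite addnS in H2.
    by rewrite (fstep_jmp _ Ej2) /=; congr pair; lia.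
  rewrite !addnS in H3 Ej3.
  have -> : o.+1 + (csize cn).+1 + (csize ct).+1 = ((o.+1 + csize cn).+1 + csize ct).+1 by lia.
  rewrite IH; last exact: H3.
  by rewrite (fstep_jmp _ Ej3) /=; congr pair; lia.
- move=> s ct cf st Es o /code_at_cons[E _].
  by rewrite iterS (fstep_pop_nil E Es) /=; congr pair; lia.
- move=> s ct cf st b l st1 st2 n1 n2 Es _ IH1 _ IH2 o H; move: (H).
  move=> /code_at_cons[E /code_at_cat[H2]].
  rewrite size_comp => /code_at_cons[Ej2 /code_at_cat[H3]].
  rewrite size_comp => /code_at_cons[Ej3 _].
  have -> : (n1 + n2).+2 = n2 + n1.+2 by lia.
  rewrite iterD iterS iterSr (fstep_pop_cons E Es).
  suff -> : fstep code (iter n1 (fstep code)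
       (if b then o.+1 else o.+1 + (csize ct).+1, store_upd st s l)) = (o, st1).
    by rewrite IH2.
  case: b IH1 Es => IH1 Es; first by rewrite IH1 // (fstep_jmp _ Ej2).
  by rewrite addnS in H3 Ej3 *; rewrite IH1 // (fstep_jmp _ Ej3).
Qed.

(** * Polynomial bounds and the running time of compiled commands *)

Definition polybound (g : seq bool -> nat) : Prop :=
  exists a k, forall x, g x <= a * (size x).+1 ^ k.

Lemma polybound_le g h : (forall x, g x <= h x) -> polybound h -> polybound g.
Proof. by move=> le [a [k H]]; exists a, k => x; exact: leq_trans (le x) (H x). Qed.

Lemma polybound_const c : polybound (fun=> c).
Proof. by exists c, 0 => x; rewrite expn0 muln1. Qed.

Lemma polybound_size : polybound size.
Proof. by exists 1, 1 => x; rewrite mul1n expn1. Qed.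

Lemma polybound_add g h : polybound g -> polybound h -> polybound (fun x => g x + h x).
Proof.
move=> [a [k H1]] [b [l H2]]; exists (a + b), (k + l) => x.
rewrite mulnDl leq_add //.
  by apply: leq_trans (H1 x) _; rewrite leq_mul2l leq_pexp2l ?leq_addr ?orbT.
by apply: leq_trans (H2 x) _; rewrite leq_mul2l leq_pexp2l ?leq_addl ?orbT.
Qed.

Lemma polybound_mul g h : polybound g -> polybound h -> polybound (fun x => g x * h x).
Proof.
move=> [a [k H1]] [b [l H2]]; exists (a * b), (k + l) => x.
by rewrite expnD mulnACA leq_mul.
Qed.

Lemma polybound_exp g k : polybound g -> polybound (fun x => g x ^ k).
Proof.
move=> H; elim: k => [|k IH]; first exact: polybound_const.
by apply: polybound_le (polybound_mul H IH) => x; rewrite expnS.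
Qed.

(** For [n > 0] one has [(n + 1) ^ k <= 2 ^ k * n ^ k], and the additive constant covers [n = 0].
    The base [(size x).+1] is used elsewhere because its powers increase with the exponent, which
    gives closure under sums. *)
Lemma polybound_standard g : polybound g ->
  exists a k, forall x, g x <= a * size x ^ k + a.
Proof.
move=> [a [k H]]; exists (a * 2 ^ k), k => x; apply: leq_trans (H x) _.
rewrite -mulnA -mulnDr leq_mul2l; apply/orP; right.
case: (size x) => [|n]; first by rewrite exp1n; have := expn_gt0 2 k; lia.
rewrite -expnMn; apply: leq_trans (leq_addr _ _); case: k {H} => // k.
by rewrite leq_exp2r //; lia.
Qed.

Lemma cmd_polytime c f T :
  polybound T ->
  (forall x, exists st n, [/\ n <= T x, exec c (init_store x) st n & rev (st 0) = f x]) ->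
  polytime_fun f.
Proof.
move=> PT H.
set K := (max_stack c).+1.
have ok : all (instr_ok (comp 0 c) K) (comp 0 c).
  by apply: comp_ok; rewrite ?size_comp // /K leqnSn.
have [a [k Hak]] : exists a k, forall x : seq bool,
    T x * (instr_cost K * (size x + T x).+1) <= a * size x ^ k + a.
  apply: (@polybound_standard (fun x => T x * (instr_cost K * (size x + T x).+1))).
  apply: polybound_mul => //; apply: polybound_mul; first exact: polybound_const.
  apply: polybound_le (polybound_add (polybound_add polybound_size PT) (polybound_const 1)).
  by move=> x; rewrite addn1.
exists (simTM (comp 0 c) K), a, k => x.
have [st [n [hn E Ef]]] := H x.
have R : iter n (fstep (comp 0 c)) (0, init_store x) = (size (comp 0 c), st).
  by rewrite (comp_correct E) ?size_comp // => i hi.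
have [t [ht Ht]] := simTM_computes (ltn0Sn _) ok R.
exists t; split; last by rewrite -Ef.
apply: leq_trans (Hak x); apply: leq_trans ht _.
by rewrite leq_mul // leq_mul2l; apply/orP; right; lia.
Qed.

(** * Loop programs and their output *)

Inductive fm :=
| FConst of bool
| FLook of nat & nat & bool
| FNot of fm
| FAnd of fm & fm.

(* Variables are de Bruijn levels into [env]; a loop counter with value [i] is
   the string [nseq i true], so that [FLook] also expresses comparisons. *)
Fixpoint feval (env : seq (seq bool)) (f : fm) : bool :=
  match f with
  | FConst b => b
  | FLook s i c => nth false (nth [::] env s) (size (nth [::] env i) + c)
  | FNot g => ~~ feval env g
  | FAnd g h => feval env g && feval env h
  end.

Inductive prog :=
| PSkip
| POut of fm
| PSeq of prog & prog
| PFor of nat & prog.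

Fixpoint out (env : seq (seq bool)) (p : prog) : seq bool :=
  match p with
  | PSkip => [::]
  | POut f => [:: feval env f]
  | PSeq p1 p2 => out env p1 ++ out env p2
  | PFor s p1 =>
      flatten [seq out (rcons env (nseq i true)) p1 | i <- iota 0 (size (nth [::] env s))]
  end.

(** Later programs may loop over the outputs of earlier ones: this is how computed bounds become
    loop ranges. *)
Definition lets (env : seq (seq bool)) (ps : seq prog) : seq (seq bool) :=
  foldl (fun env p => rcons env (out env p)) env ps.

(** * Compilation of loop programs to stack commands *)

(* Stack 0 is the input/output, 1-3 are scratch, 4 holds truth values, 5 the
   output produced so far (reversed); level [j] owns stacks [var j] and [aux j]. *)
Definition var (j : nat) : nat := 6 + j.*2.
Definition aux (j : nat) : nat := 7 + j.*2.

Lemma exec_eq c st st' st'' n : exec c st st' n -> st' =1 st'' -> exec c st st'' n.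
Proof. by move=> E H; have <- : st' = st'' by apply: functional_extensionality. Qed.

Lemma exec_eq2 c st0 st st' st'' n :
  exec c st st' n -> st0 =1 st -> st' =1 st'' -> exec c st0 st'' n.
Proof.
move=> E H H'; have -> : st0 = st by apply: functional_extensionality.
exact: exec_eq E H'.
Qed.

(** [I p l] is the invariant: the whole store once the prefix [p] of the stack has been consumed and
    [l] remains. Each round costs a pop and a jump more than its body. *)
Lemma exec_loop s ct cf (I : seq bool -> seq bool -> store) B q :
  (forall p l, I p l s = l) ->
  (forall p b l, q = p ++ b :: l -> exists n, n <= B /\
     exec (if b then ct else cf) (store_upd (I p (b :: l)) s l) (I (rcons p b) l) n) ->
  exists n, n <= size q * B.+2 + 1 /\ exec (Loop s ct cf) (I [::] q) (I q [::]) n.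
Proof.
move=> Is H.
suff : forall l p, q = p ++ l ->
    exists n, n <= size l * B.+2 + 1 /\ exec (Loop s ct cf) (I p l) (I q [::]) n.
  by move/(_ q [::] erefl).
elim=> [|b l IH] p E.
  by exists 1; split=> //; move: E; rewrite cats0 => <-; exact: ExLoopN.
have [n1 [h1 E1]] := H p b l E.
have [|n2 [h2 E2]] := IH (rcons p b); first by rewrite cat_rcons.
exists (n1 + n2).+2; split; first by rewrite /= mulSn; lia.
by apply: ExLoopC E1 E2; exact: Is.
Qed.

Ltac store_ext :=
  let r := fresh "r" in
  move=> r; rewrite /store_upd; repeat (case: eqP => [?|?]; subst => //).

Definition move_stack (src dst : nat) : cmd := Loop src (Push dst true) (Push dst false).

Lemma exec_move src dst st : src != dst ->
  exists n, n <= (size (st src)).*2.*2 + 1 /\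
    exec (move_stack src dst) st
      (store_upd (store_upd st dst (rev (st src) ++ st dst)) src [::]) n.
Proof.
move=> ne.
have [||n [hn E]] := @exec_loop src (Push dst true) (Push dst false)
  (fun p l => store_upd (store_upd st dst (rev p ++ st dst)) src l) 1 (st src).
- by move=> p l; rewrite /store_upd eqxx.
- move=> p b l _; exists 1; split=> //.
  have -> : (if b then Push dst true else Push dst false) = Push dst b by case: b.
  apply: exec_eq (ExPush _ _ _) _; rewrite rev_rcons /=.
  by store_ext; rewrite eqxx in ne.
exists n; split; first lia.
have -> : st = store_upd (store_upd st dst (rev [::] ++ st dst)) src (st src).
  by apply: functional_extensionality; store_ext.
by apply: exec_eq E _; store_ext; rewrite ?eqxx.
Qed.

Definition clear_stack (s : nat) : cmd := Loop s Skip Skip.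

Lemma exec_clear s st :
  exists n, n <= (size (st s)).*2 + 1 /\ exec (clear_stack s) st (store_upd st s [::]) n.
Proof.
have [||n [hn E]] := @exec_loop s Skip Skip (fun p l => store_upd st s l) 0 (st s).
- by move=> p l; rewrite /store_upd eqxx.
- move=> p b l _; exists 0; split=> //.
  have -> : (if b then Skip else Skip) = Skip by case: b.
  by apply: exec_eq (ExSkip _) _; store_ext.
exists n; split; first lia.
have {1}-> : st = store_upd st s (st s).
  by apply: functional_extensionality; store_ext.
by [].
Qed.

(** The move onto the scratch stack 1 reverses the string, and unloading it onto both stacks
    restores the order. *)
Definition copy_stack (src dst : nat) : cmd :=
  Seq (move_stack src 1)
      (Loop 1 (Seq (Push src true) (Push dst true)) (Seq (Push src false) (Push dst false))).

Lemma exec_copy src dst st : src != 1 -> dst != 1 -> src != dst -> st 1 = [::] ->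
  exists n, n <= 8 * (size (st src)).+1 /\
    exec (copy_stack src dst) st (store_upd st dst (st src ++ st dst)) n.
Proof.
move=> n1 n2 n3 E1.
have [n [hn E]] := exec_move st n1.
have [||m [hm E']] := @exec_loop 1 (Seq (Push src true) (Push dst true))
  (Seq (Push src false) (Push dst false))
  (fun p l => store_upd (store_upd (store_upd st src (rev p)) dst (rev p ++ st dst)) 1 l)
  2 (rev (st src)).
- by move=> p l; rewrite /store_upd eqxx.
- move=> p b l _; exists 2; split=> //.
  have -> : (if b then Seq (Push src true) (Push dst true) else Seq (Push src false) (Push dst false))
    = Seq (Push src b) (Push dst b) by case: b.
  apply: exec_eq (ExSeq (ExPush _ _ _) (ExPush _ _ _)) _; rewrite rev_rcons /=.
  by store_ext; rewrite eqxx in n1 n2 n3.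
exists (n + m); split; first by rewrite size_rev in hm; lia.
apply: ExSeq E _; apply: exec_eq2 E' _ _.
  by store_ext; rewrite ?E1 ?cats0 ?revK //; move: n1 n2 n3; rewrite ?eqxx.
by store_ext; rewrite ?E1 ?cats0 ?revK //; move: n1 n2 n3; rewrite ?eqxx.
Qed.

(** Copies of the string and of the counter are consumed in parallel, so the wanted bit comes to the
    top of stack 2; an exhausted stack yields [false], the default of [nth] in [feval]. *)
Definition look (s i : nat) (c : bool) : cmd :=
  Seq (copy_stack s 2) (Seq (copy_stack i 3) (Seq (if c then Push 3 true else Skip)
    (Seq (Loop 3 (Pop 2 Skip Skip Skip) (Pop 2 Skip Skip Skip))
      (Seq (Pop 2 (Push 4 false) (Push 4 true) (Push 4 false)) (clear_stack 2))))).

Lemma exec_look s i c st : 5 < s -> 5 < i -> st 1 = [::] -> st 2 = [::] -> st 3 = [::] ->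
  exists n, n <= 30 * (size (st s) + size (st i)).+1 /\
    exec (look s i c) st
      (store_upd st 4 (nth false (st s) (size (st i) + c) :: st 4)) n.
Proof.
move=> hs hi E1 E2 E3.
have s_ne k : k <= 5 -> (s == k) = false by lia.
have i_ne k : k <= 5 -> (i == k) = false by lia.
have [||||n1 [h1 X1]] := @exec_copy s 2 st => //; try by rewrite s_ne.
set st1 := store_upd _ _ _ in X1.
have [||||n2 [h2 X2]] := @exec_copy i 3 st1 => //; try by rewrite i_ne.
have Ei : st1 i = st i by rewrite /st1 /store_upd i_ne.
rewrite Ei in h2 X2.
set q := nseq c true ++ st i.
pose st3 := store_upd (store_upd st 2 (st s)) 3 q.
have X3 : exec (if c then Push 3 true else Skip)
     (store_upd st1 3 (st i ++ st1 3)) st3 c.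
  rewrite /st3 /q /st1; case: (c) => /=.
    apply: exec_eq (ExPush _ _ _) _.
    by store_ext; rewrite /= ?E2 ?E3 ?cats0.
  apply: exec_eq (ExSkip _) _.
  by store_ext; rewrite /= ?E2 ?E3 ?cats0.
have [||n4 [h4 X4]] := @exec_loop 3 (Pop 2 Skip Skip Skip) (Pop 2 Skip Skip Skip)
  (fun p l => store_upd (store_upd st 2 (drop (size p) (st s))) 3 l) 2 q.
- by move=> p l; rewrite /store_upd eqxx.
- move=> p b l _; exists 2; split=> //.
  have -> : (if b then Pop 2 Skip Skip Skip else Pop 2 Skip Skip Skip) =
    Pop 2 Skip Skip Skip by case: b.
  case E: (drop (size p) (st s)) => [|b' l'].
    have Ed : drop (size p).+1 (st s) = [::].
      by apply: drop_oversize; move: (congr1 size E); rewrite size_drop /=; lia.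
    apply: exec_eq (ExPopN _ _ _ (ExSkip _)) _ => //.
    by rewrite size_rcons Ed; store_ext.
  have Ed : drop (size p).+1 (st s) = l'.
    by rewrite -addn1 addnC -drop_drop E /= drop0.
  apply: exec_eq.
    apply: (@ExPopC _ _ _ _ _ b' l'); first by rewrite /store_upd.
    have -> : (if b' then Skip else Skip) = Skip by case: (b').
    exact: ExSkip.
  by rewrite size_rcons Ed; store_ext.
have Eq : size q = size (st i) + c by rewrite size_cat size_nseq addnC.
rewrite Eq in h4.
pose v := nth false (st s) (size (st i) + c).
have [l [hl [n5 [h5 X5]]]] : exists l, size l <= size (st s) /\ exists n, n <= 3 /\
   exec (Pop 2 (Push 4 false) (Push 4 true) (Push 4 false))
     (store_upd (store_upd st 2 (drop (size q) (st s))) 3 [::])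
     (store_upd (store_upd st 2 l) 4 (v :: st 4)) n.
  case E: (drop (size q) (st s)) => [|b' l'].
    exists [::]; split=> //; exists 3; split=> //.
    have -> : v = false.
      rewrite /v -Eq nth_default //.
      by move: (congr1 size E); rewrite size_drop /=; lia.
    by apply: exec_eq (ExPopN _ _ _ (ExPush _ _ _)) _ => //; store_ext.
  exists l'; split; first by move: (congr1 size E); rewrite size_drop /=; lia.
  exists 3; split=> //.
  have -> : v = b' by rewrite /v -Eq -[size q]addn0 -nth_drop E.
  apply: exec_eq.
    apply: (@ExPopC _ _ _ _ _ b' l'); first by rewrite /store_upd.
    have -> : (if b' then Push 4 true else Push 4 false) = Push 4 b' by case: (b').
    exact: ExPush.
  by store_ext.
have [n6 [h6 X6]] := exec_clear 2 (store_upd (store_upd st 2 l) 4 (v :: st 4)).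
exists (n1 + (n2 + (c + (n4 + (n5 + n6))))); split.
  by move: h6; rewrite /store_upd /=; case: (c) h4; lia.
apply: ExSeq X1 _; apply: ExSeq X2 _; apply: ExSeq X3 _.
apply: ExSeq; first by apply: exec_eq2 X4 _ _ => [|r]; [rewrite /st3 drop0; store_ext | reflexivity].
apply: ExSeq X5 _; apply: exec_eq X6 _.
by store_ext.
Qed.

(** In a conjunction the value of [h] is on top: if it is true, the value of [g] beneath it is
    already the answer; if not, that value is replaced by [false]. *)
Fixpoint cfm (f : fm) : cmd :=
  match f with
  | FConst b => Push 4 b
  | FLook s i c => look (var s) (var i) c
  | FNot g => Seq (cfm g) (Pop 4 Skip (Push 4 false) (Push 4 true))
  | FAnd g h => Seq (cfm g) (Seq (cfm h)
      (Pop 4 Skip Skip (Pop 4 Skip (Push 4 false) (Push 4 false))))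
  end.

(** Enclosing loops keep their remaining rounds on [aux j] for [j < size env], so these stacks are
    left free. For an unbound level the default of [nth] says that [var j] is empty. *)
Definition matches (env : seq (seq bool)) (st : store) : Prop :=
  [/\ st 1 = [::], st 2 = [::], st 3 = [::], (forall j, st (var j) = nth [::] env j) &
      forall j, size env <= j -> st (aux j) = [::]].

Definition env_bounded (S : nat) (env : seq (seq bool)) : Prop :=
  forall j, size (nth [::] env j) <= S.

Lemma var_neq j k : k <= 5 -> (var j == k) = false.
Proof. by rewrite /var; lia. Qed.

Lemma aux_neq j k : k <= 5 -> (aux j == k) = false.
Proof. by rewrite /aux; lia. Qed.

Lemma var_eq j k : (var j == var k) = (j == k).
Proof. by rewrite /var; lia. Qed.

Lemma aux_eq j k : (aux j == aux k) = (j == k).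
Proof. by rewrite /aux; lia. Qed.

Lemma var_aux j k : (var j == aux k) = false.
Proof. by rewrite /var /aux; lia. Qed.

Lemma aux_var j k : (aux j == var k) = false.
Proof. by rewrite /var /aux; lia. Qed.

Lemma matches_upd env st k l : 3 < k <= 5 -> matches env st -> matches env (store_upd st k l).
Proof.
move=> hk [E1 E2 E3 Ev Ea]; rewrite /store_upd; split; try by case: eqP => //; lia.
  by move=> j; rewrite var_neq ?Ev //; lia.
by move=> j hj; rewrite aux_neq ?Ea //; lia.
Qed.

Fixpoint fm_cost (f : fm) : nat :=
  match f with
  | FConst _ => 1
  | FLook _ _ _ => 60
  | FNot g => fm_cost g + 3
  | FAnd g h => fm_cost g + fm_cost h + 5
  end.

Lemma exec_fm f env st S : matches env st -> env_bounded S env ->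
  exists n, n <= fm_cost f * S.+1 /\
    exec (cfm f) st (store_upd st 4 (feval env f :: st 4)) n.
Proof.
move=> Hm HS; elim: f st Hm => [b|s i c|g IHg|g IHg h IHh] st Hm /=.
- by exists 1; split=> //; exact: ExPush.
- case: (Hm) => E1 E2 E3 Ev _.
  have [//|//|n [hn X]] := @exec_look (var s) (var i) c st _ _ E1 E2 E3.
  rewrite !Ev in hn X; exists n; split=> //.
  by have := HS s; have := HS i; lia.
- have [n [hn X]] := IHg st Hm.
  exists (n + 3); split; first by rewrite mulnDl leq_add //; lia.
  apply: ExSeq X _; apply: exec_eq.
    apply: (@ExPopC _ _ _ _ _ (feval env g) (st 4)); first by rewrite /store_upd.
    have -> : (if feval env g then Push 4 false else Push 4 true) =
      Push 4 (~~ feval env g) by case: feval.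
    exact: ExPush.
  by store_ext.
- have [n1 [h1 X1]] := IHg st Hm.
  have Hm1 := @matches_upd env st 4 (feval env g :: st 4) isT Hm.
  have [n2 [h2 X2]] := IHh _ Hm1.
  have [n3 [h3 X3]] : exists n, n <= 5 /\
     exec (Pop 4 Skip Skip (Pop 4 Skip (Push 4 false) (Push 4 false)))
     (store_upd (store_upd st 4 (feval env g :: st 4)) 4
         (feval env h :: feval env g :: st 4))
     (store_upd st 4 (feval env g && feval env h :: st 4)) n.
    case: (feval env h); rewrite ?andbT ?andbF.
      exists 2; split=> //; apply: exec_eq.
        by apply: (@ExPopC _ _ _ _ _ true (feval env g :: st 4)); [rewrite /store_upd | exact: ExSkip].
      by store_ext.
    exists 5; split=> //; apply: exec_eq.
      apply: (@ExPopC _ _ _ _ _ false (feval env g :: st 4)); first by rewrite /store_upd.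
      apply: (@ExPopC _ _ _ _ _ (feval env g) (st 4)); first by rewrite /store_upd.
      have -> : (if feval env g then Push 4 false else Push 4 false) = Push 4 false
        by case: feval.
      exact: ExPush.
    by store_ext.
  exists (n1 + (n2 + n3)); split; first by rewrite !mulnDl -addnA !leq_add //; lia.
  apply: ExSeq X1 _; apply: ExSeq X2 _.
  by apply: exec_eq2 X3 _ _ => r; rewrite /store_upd.
Qed.

(** [d] is the first unbound level. A loop consumes a copy of its range on [aux d], with the same
    body for either bit since only the length counts, while [var d] grows by one [true] per
    round. *)
Fixpoint cprog (d : nat) (p : prog) : cmd :=
  match p with
  | PSkip => Skip
  | POut f => Seq (cfm f) (Pop 4 Skip (Push 5 true) (Push 5 false))
  | PSeq p1 p2 => Seq (cprog d p1) (cprog d p2)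
  | PFor s p1 =>
      let body := Seq (cprog d.+1 p1) (Push (var d) true) in
      Seq (copy_stack (var s) (aux d)) (Seq (Loop (aux d) body body) (clear_stack (var d)))
  end.

Lemma env_bounded_rcons S env l : env_bounded S env -> size l <= S -> env_bounded S (rcons env l).
Proof.
move=> H hl j; rewrite nth_rcons; case: ltnP => // _.
by case: eqP.
Qed.

Lemma size_flatten_iota (F : nat -> seq bool) m B :
  (forall i, i < m -> size (F i) <= B) -> size (flatten [seq F i | i <- iota 0 m]) <= m * B.
Proof.
elim: m => [//|m IH] H.
rewrite -addn1 iotaD map_cat flatten_cat size_cat /= cats0 mulnDl mul1n.
by rewrite leq_add ?H ?IH // => i hi; rewrite H // ltnW.
Qed.

(** [C] and [e] depend on the program alone, because a loop body meets another environment in each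
    round; the bound [S] survives since a counter stays below the length of its range. *)
Lemma size_out p : exists C e, forall env S, env_bounded S env ->
  size (out env p) <= C * S.+1 ^ e.
Proof.
elim: p => [|f|p1 [C1 [e1 H1]] p2 [C2 [e2 H2]]|s p [C [e H]]].
- by exists 0, 0.
- by exists 1, 0.
- exists (C1 + C2), (e1 + e2) => env S hS /=; rewrite size_cat mulnDl leq_add //.
    by apply: leq_trans (H1 _ _ hS) _; rewrite leq_mul2l leq_pexp2l ?leq_addr ?orbT.
  by apply: leq_trans (H2 _ _ hS) _; rewrite leq_mul2l leq_pexp2l ?leq_addl ?orbT.
- exists C, e.+1 => env S hS /=.
  apply: (@leq_trans (size (nth [::] env s) * (C * S.+1 ^ e))); last first.
    by rewrite expnS [C * (_ * _)]mulnCA leq_mul //; have := hS s; lia.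
  apply: size_flatten_iota => i hi; apply: H; apply: env_bounded_rcons => //.
  by rewrite size_nseq; have := hS s; lia.
Qed.

Lemma exec_prog p : exists C e, forall env st S, matches env st -> env_bounded S env ->
  exists n, n <= C * S.+1 ^ e /\
    exec (cprog (size env) p) st (store_upd st 5 (rev (out env p) ++ st 5)) n.
Proof.
elim: p => [|f|p1 [C1 [e1 H1]] p2 [C2 [e2 H2]]|s p [C [e H]]].
- exists 0, 0 => env st S _ _; exists 0; split=> //.
  by apply: exec_eq (ExSkip _) _; store_ext.
- exists (fm_cost f + 3), 1 => env st S Hm hS.
  have [n [hn X]] := exec_fm f Hm hS.
  exists (n + 3); split; first by rewrite expn1 mulnDl leq_add //; lia.
  apply: ExSeq X _; apply: exec_eq.
    apply: (@ExPopC _ _ _ _ _ (feval env f) (st 4)); first by rewrite /store_upd.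
    have -> : (if feval env f then Push 5 true else Push 5 false) =
      Push 5 (feval env f) by case: feval.
    exact: ExPush.
  by store_ext.
- exists (C1 + C2), (e1 + e2) => env st S Hm hS.
  have [n1 [h1 X1]] := H1 env st S Hm hS.
  have [n2 [h2 X2]] := H2 env _ S (@matches_upd _ _ 5 (rev (out env p1) ++ st 5) isT Hm) hS.
  exists (n1 + n2); split.
    rewrite mulnDl leq_add //.
      by apply: leq_trans h1 _; rewrite leq_mul2l leq_pexp2l ?leq_addr ?orbT.
    by apply: leq_trans h2 _; rewrite leq_mul2l leq_pexp2l ?leq_addl ?orbT.
  apply: ExSeq X1 _; apply: exec_eq X2 _; rewrite /= rev_cat.
  by store_ext; rewrite catA.
- exists (C + 20), e.+1 => env st S Hm hS.
  case: (Hm) => E1 E2 E3 Ev Ea.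
  set d := size env; set L := nth [::] env s.
  have Evd : st (var d) = [::] by rewrite Ev nth_default.
  have Ead : st (aux d) = [::] by rewrite Ea.
  have [||||n1 [h1 X1]] := @exec_copy (var s) (aux d) st => //.
    by rewrite var_aux.
  rewrite Ev Ead cats0 -/L in h1 X1.
  (* [F m] is the output of the first [m] rounds; the invariant has it reversed on stack 5 and the
     number of rounds on [var d]. *)
  pose F m := flatten [seq out (rcons env (nseq i true)) p | i <- iota 0 m].
  pose body := Seq (cprog d.+1 p) (Push (var d) true).
  pose B := C * S.+1 ^ e + 1.
  have hL : size L <= S := hS s.
  have [||n2 [h2 X2]] := @exec_loop (aux d) body body
    (fun q l => store_upd (store_upd (store_upd st 5 (rev (F (size q)) ++ st 5))
       (var d) (nseq (size q) true)) (aux d) l) B L.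
  - by move=> q l; rewrite /store_upd eqxx.
  - move=> q b l EL.
    have -> : (if b then body else body) = body by case: b {EL}.
    set env' := rcons env (nseq (size q) true).
    set st0 := store_upd _ _ l.
    have hq : size q <= S by move: hL; rewrite EL size_cat /=; lia.
    have Hm0 : matches env' st0.
      rewrite /st0 /store_upd /env'; split.
      + by rewrite !(eq_sym 1) aux_neq ?var_neq.
      + by rewrite !(eq_sym 2) aux_neq ?var_neq.
      + by rewrite !(eq_sym 3) aux_neq ?var_neq.
      + move=> j; rewrite var_aux var_eq var_neq // nth_rcons -/d.
        by case: ltngtP => // hj; rewrite Ev // nth_default // ltnW.
      + move=> j; rewrite size_rcons -/d => hj; rewrite aux_eq aux_var aux_neq //.
        by rewrite Ea ?(ltnW hj) //; case: eqP => // ejd; move: hj; rewrite ejd ltnn.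
    have hS' : env_bounded S env' by apply: env_bounded_rcons; rewrite ?size_nseq.
    have [n [hn X]] := H env' st0 S Hm0 hS'.
    rewrite size_rcons -/d in X.
    exists (n + 1); split; first by rewrite leq_add2r.
    apply: ExSeq X _; apply: exec_eq (ExPush _ _ _) _ => r.
    rewrite /st0 /store_upd !size_rcons.
    have -> : F (size q).+1 = F (size q) ++ out env' p.
      by rewrite /F -addn1 iotaD map_cat flatten_cat /= cats0.
    rewrite rev_cat -catA.
    have [->|n_v] := eqVneq r (var d).
      by rewrite ?eqxx ?var_aux ?var_neq.
    have [->|n_5] := eqVneq r 5.
      by rewrite ?eqxx ?(eq_sym 5) ?aux_neq ?var_neq.
    by case: (r == aux d).
  have [n3 [h3 X3]] := exec_clear (var d) (store_upd (store_upd (store_upd st 5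
     (rev (F (size L)) ++ st 5)) (var d) (nseq (size L) true)) (aux d) [::]).
  exists (n1 + (n2 + n3)); split.
    move: h3; rewrite {1}/store_upd var_aux {1}/store_upd eqxx size_nseq => h3.
    rewrite expnS; move: h2; rewrite /B; set X := S.+1 ^ e => h2.
    have X_gt0 : 0 < X by rewrite expn_gt0.
    have : size L * (C * X + 1).+2 <= S * (C * X + 3) by rewrite leq_mul //; lia.
    by clear -h1 h2 h3 hL X_gt0; nia.
  apply: ExSeq X1 _; apply: ExSeq; last first.
    apply: exec_eq X3 _ => r; rewrite /store_upd.
    have [->|n_v] := eqVneq r (var d); first by rewrite var_neq.
    by have [->|n_a] := eqVneq r (aux d); rewrite ?aux_neq.
  apply: exec_eq2 X2 _ _ => [r|r //]; rewrite /store_upd.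
  have [//|n_a] := eqVneq r (aux d).
  have [->|n_v] := eqVneq r (var d); first by rewrite Evd.
  by have [->|] := eqVneq r 5.
Qed.

(** Moving stack 5 to [var d] undoes the reversal of the output. The final move reverses the last
    string once more, as the layout of stack 0 requires. *)
Fixpoint clets (d : nat) (ps : seq prog) : cmd :=
  match ps with
  | [::] => move_stack (var d.-1) 0
  | p :: ps' => Seq (cprog d p) (Seq (move_stack 5 (var d)) (clets d.+1 ps'))
  end.

(** [E] and [S] are functions of the input so that one polynomial serves all inputs; each program
    enlarges [S] by its own output bound [C1 * S.+1 ^ e1]. *)
Lemma exec_lets ps d (E : seq bool -> seq (seq bool)) S :
  (forall x, size (E x) = d.+1) -> polybound S -> (forall x, env_bounded (S x) (E x)) ->
  exists T, polybound T /\ forall x st, matches (E x) st -> st 5 = [::] -> st 0 = [::] ->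
    exists st' n, [/\ n <= T x, exec (clets d.+1 ps) st st' n &
      rev (st' 0) = last [::] (lets (E x) ps)].
Proof.
elim: ps d E S => [|p ps IH] d E S hE hS hES.
  exists (fun x => 4 * S x + 1); split.
    apply: polybound_add (polybound_const 1); apply: polybound_mul hS; exact: polybound_const.
  move=> x st [_ _ _ Ev _] _ E0.
  have [//|n [hn X]] := @exec_move (var d) 0 st; exists (store_upd (store_upd st 0
      (rev (st (var d)) ++ st 0)) (var d) [::]), n; split=> //.
    by apply: leq_trans hn _; rewrite Ev; have := hES x d; lia.
  rewrite /store_upd !(eq_sym 0) eqxx var_neq // E0 cats0 revK Ev.
  by rewrite /lets /= -nth_last hE.
have [C1 [e1 H1]] := size_out p.
have [C2 [e2 H2]] := exec_prog p.
pose Out x := C1 * (S x).+1 ^ e1.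
have hexp C e : polybound (fun x => C * (S x).+1 ^ e).
  apply: polybound_mul; first exact: polybound_const.
  apply: polybound_exp; apply: polybound_le (polybound_add hS (polybound_const 1)) => x.
  by rewrite addn1.
pose E' x := rcons (E x) (out (E x) p).
have hE' x : size (E' x) = d.+2 by rewrite size_rcons hE.
have hS' : polybound (fun x => S x + Out x) by apply: polybound_add => //; exact: hexp.
have hES' x : env_bounded (S x + Out x) (E' x).
  apply: env_bounded_rcons => [j|]; first by apply: leq_trans (hES x j) _; rewrite leq_addr.
  by apply: leq_trans (H1 _ _ (hES x)) _; rewrite leq_addl.
have [T [hT HT]] := IH _ _ _ hE' hS' hES'.
exists (fun x => C2 * (S x).+1 ^ e2 + ((Out x) * 4 + 1 + T x)); split.
  apply: polybound_add; first exact: hexp.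
  apply: polybound_add hT; apply: polybound_add (polybound_const 1).
  by apply: polybound_mul (polybound_const 4); exact: hexp.
move=> x st Hm E5 E0.
have [n1 [h1 X1]] := H2 _ _ _ Hm (hES x); rewrite E5 cats0 in X1.
set st1 := store_upd _ _ _ in X1.
have [//|n2 [h2 X2]] := @exec_move 5 (var d.+1) st1.
set st2 := store_upd _ _ _ in X2.
have E15 : st1 5 = rev (out (E x) p) by [].
case: (Hm) => Z1 Z2 Z3 Zv Za.
have Zd : st (var d.+1) = [::] by rewrite Zv nth_default // hE.
have Hm2 : matches (E' x) st2.
  rewrite /st2 E15 revK /E'; split=> //.
    move=> j; rewrite {1}/store_upd var_neq // {1}/store_upd var_eq nth_rcons hE.
    rewrite /st1 /store_upd /=; case: ltngtP => [hj|hj|hj] //.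
      by rewrite Zv nth_default // hE ltnW.
    by rewrite Zd cats0.
  move=> j; rewrite size_rcons hE => hj.
  by rewrite /store_upd aux_neq // aux_var /st1 /store_upd aux_neq // Za // hE ltnW.
have [|||st3 [n3 [h3 X3 Ef]]] := HT x st2 => //.
exists st3, (n1 + (n2 + n3)); split=> //.
  rewrite leq_add // ?leq_add //.
  apply: leq_trans h2 _; rewrite E15 size_rev leq_add2r.
  by have := H1 _ _ (hES x); rewrite -/(Out x); lia.
by rewrite hE in X1; apply: ExSeq X1 _; apply: ExSeq X2 X3.
Qed.

Theorem loop_polytime ps : polytime_fun (fun x => last [::] (lets [:: x] ps)).
Proof.
have bnd (x : seq bool) : env_bounded (size x) [:: x] by case=> [|j] //=; rewrite nth_nil.
have [T [hT HT]] := @exec_lets ps 0 (fun x => [:: x]) size (fun=> erefl) polybound_size bnd.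
apply: (@cmd_polytime (Seq (move_stack 0 (var 0)) (clets 1 ps)) _
          (fun x => size x * 4 + 1 + T x)).
  apply: polybound_add hT; apply: polybound_add (polybound_const 1).
  exact: polybound_mul polybound_size (polybound_const 4).
move=> x; have [//|n1 [h1 X1]] := @exec_move 0 (var 0) (init_store x).
have E0 : init_store x 0 = rev x by [].
set st1 := store_upd _ _ _ in X1.
have Hm : matches [:: x] st1.
  rewrite /st1 E0 revK; split=> //.
    case=> [|j]; rewrite /store_upd /init_store /= ?cats0 //.
    by rewrite nth_nil.
have [|||st' [n2 [h2 X2 Ef]]] := HT x st1 => //.
exists st', (n1 + n2); split=> //; last exact: ExSeq X1 X2.
by rewrite leq_add //; apply: leq_trans h1 _; rewrite E0 size_rev; lia.
Qed.

(** * Clauses as triangle-free graphs *)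

(* Vertices 0..10 form the Groetzsch graph (the Mycielskian of the 5-cycle
   6..10, with apex 0) without the edge 0-1: since the Groetzsch graph is not
   3-colourable, every 3-colouring gives 0 and 1 the same colour "base".
   Vertex 11 has the colour "true", and 12, 13, 14 the colour "false". *)
Definition palette_edges : seq (nat * nat) :=
  [:: (6, 7); (7, 8); (8, 9); (9, 10); (10, 6);
      (1, 7); (1, 10); (2, 6); (2, 8); (3, 7); (3, 9); (4, 8); (4, 10); (5, 9); (5, 6);
      (0, 2); (0, 3); (0, 4); (0, 5);
      (11, 0); (11, 12); (11, 13); (11, 14); (12, 1); (13, 1); (14, 1)].

Definition pal_adj (p q : nat) : bool :=
  ((p, q) \in palette_edges) || ((q, p) \in palette_edges).

Definition palette_coloring : seq nat :=
  [:: 2; 2; 0; 1; 0; 1; 2; 0; 1; 0; 1; 1; 0; 0; 0].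

Definition forall_color (P : nat -> bool) : bool := [&& P 0, P 1 & P 2].

Lemma forall_colorP P : forall_color P -> forall a, a < 3 -> P a.
Proof. by move=> /and3P[P0 P1 P2] [|[|[|a]]]. Qed.

(** By enumeration: the [u]s colour the 5-cycle, the [v]s the Mycielski twins of its vertices, [w]
    the apex. Each [if] abandons a partial colouring as soon as an edge is violated, which keeps the
    search small. *)
Lemma groetzsch_minus_edge (f : nat -> nat) :
  (forall p, p < 15 -> f p < 3) -> (forall p q, pal_adj p q -> f p != f q) -> f 0 = f 1.
Proof.
move=> f3 fadj.
have : forall_color (fun u0 => forall_color (fun u1 => if u0 == u1 then true else
  forall_color (fun u2 => if u1 == u2 then true else
  forall_color (fun u3 => if u2 == u3 then true else
  forall_color (fun u4 => if (u3 == u4) || (u4 == u0) then true else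
  forall_color (fun w =>
  forall_color (fun v1 => if [|| w == v1, v1 == u0 | v1 == u2] then true else
  forall_color (fun v2 => if [|| w == v2, v2 == u1 | v2 == u3] then true else
  forall_color (fun v3 => if [|| w == v3, v3 == u2 | v3 == u4] then true else
  forall_color (fun v4 => if [|| w == v4, v4 == u3 | v4 == u0] then true else
  forall_color (fun v0 => if (v0 == u1) || (v0 == u4) then true else w == v0)
  )))))))))) by vm_compute.
have ne p q : pal_adj p q -> (f p == f q) = false by move/fadj/negbTE.
move=> /forall_colorP/(_ (f 6) (f3 6 isT)).
move=> /forall_colorP/(_ (f 7) (f3 7 isT)); rewrite ne //.
move=> /forall_colorP/(_ (f 8) (f3 8 isT)); rewrite ne //.
move=> /forall_colorP/(_ (f 9) (f3 9 isT)); rewrite ne //.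
move=> /forall_colorP/(_ (f 10) (f3 10 isT)); rewrite !ne //=.
move=> /forall_colorP/(_ (f 0) (f3 0 isT)).
move=> /forall_colorP/(_ (f 2) (f3 2 isT)); rewrite !ne //=.
move=> /forall_colorP/(_ (f 3) (f3 3 isT)); rewrite !ne //=.
move=> /forall_colorP/(_ (f 4) (f3 4 isT)); rewrite !ne //=.
move=> /forall_colorP/(_ (f 5) (f3 5 isT)); rewrite !ne //=.
move=> /forall_colorP/(_ (f 1) (f3 1 isT)); rewrite (ne 1 7) // (ne 1 10) //=.
by move/eqP.
Qed.

Lemma odd_cycle (a c0 c1 c2 c3 c4 : nat) :
  a < 3 -> c0 < 3 -> c1 < 3 -> c2 < 3 -> c3 < 3 -> c4 < 3 ->
  c0 != a -> c1 != a -> c2 != a -> c3 != a -> c4 != a ->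
  c0 != c1 -> c1 != c2 -> c2 != c3 -> c3 != c4 -> c4 != c0 -> False.
Proof. lia. Qed.

Section ClauseGraph.
Variables (X C : eqType) (act : C -> bool).
Variables (prem1 prem2 conc1 conc2 : C -> option X).

Definition clause_holds (val : X -> bool) (c : C) : bool :=
  oapp val true (prem1 c) && oapp val true (prem2 c) ==>
  oapp val false (conc1 c) || oapp val false (conc2 c).

Definition vtx : eqType := (nat + X * bool + C * nat)%type.
Definition Pal (p : nat) : vtx := inl (inl p).
Definition Lit (x : X) (s : bool) : vtx := inl (inr (x, s)).
Definition Cyc (c : C) (k : nat) : vtx := inr (c, k).

(** An absent literal counts as false. Vertex 12 stands for an absent conclusion, 14 for an absent
    premise and 13 for the fifth literal, so that neighbours on a cycle are attached to different
    vertices; the alternation of signs in [attach] achieves the same for variables. *)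
Definition pos (o : option X) : nat + X * bool :=
  if o is Some x then inr (x, true) else inl 12.
Definition neg (o : option X) : nat + X * bool :=
  if o is Some x then inr (x, false) else inl 14.

(* An odd cycle all of whose vertices avoid one and the same colour does not
   exist, so the 5-cycle of a clause says that its literals are not all equal;
   the last one being false, the clause holds. *)
Definition attach (c : C) (k : nat) : nat + X * bool :=
  match k with
  | 0 => neg (prem1 c)
  | 1 => pos (conc1 c)
  | 2 => neg (prem2 c)
  | 3 => pos (conc2 c)
  | _ => inl 13
  end.

(** [p == ~~ s] ties positive literals to base vertex 0 and negative ones to base vertex 1, which
    avoids the triangle of a literal, its negation and base. *)
Definition half_adj (u v : vtx) : bool :=
  match u, v with
  | inl (inl p), inl (inl q) => (p, q) \in palette_edges
  | inl (inl p), inl (inr (_, s)) => p == ~~ s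
  | inl (inr (x, s)), inl (inr (y, s')) => [&& x == y, s & ~~ s']
  | inr (c, k), inr (d, l) => [&& c == d, k < 5 & l == k.+1 %% 5]
  | inr (c, k), inl w => act c && (attach c k == w)
  | _, _ => false
  end.

Definition adj (u v : vtx) : bool := half_adj u v || half_adj v u.

Lemma adj_sym : symmetric adj.
Proof. by move=> u v; rewrite /adj orbC. Qed.

Lemma palette_lt p q : pal_adj p q -> p < 15.
Proof.
have H : all (fun e => (e.1 < 15) && (e.2 < 15)) palette_edges by [].
by rewrite /pal_adj => /orP[] /(allP H) /= /andP[].
Qed.

Lemma palette_triangle p q r : pal_adj p q -> pal_adj q r -> pal_adj r p -> False.
Proof.
move=> pq qr rp.
have : all (fun p => all (fun q => if pal_adj p q then
    all (fun r => ~~ (pal_adj q r && pal_adj r p)) (iota 0 15) else true) (iota 0 15)) (iota 0 15).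
  by vm_compute.
have m (a b : nat) : pal_adj a b -> a \in iota 0 15 by rewrite mem_iota => /palette_lt.
move=> /allP/(_ p (m _ _ pq))/allP/(_ q (m _ _ qr)); rewrite pq.
by move=> /allP/(_ r (m _ _ rp)); rewrite qr rp.
Qed.

Lemma adj_irr : irreflexive adj.
Proof.
rewrite /adj => u; rewrite orbb; case: u => [[p|[x s]]|[c k]] /=.
(* A loop would be a degenerate triangle, and the enumeration excludes these as well. *)
- apply/negbTE/negP => h; apply: (@palette_triangle p p p); by rewrite /pal_adj h.
- by rewrite eqxx; case: s.
- by rewrite eqxx /=; lia.
Qed.

Lemma attach_succ c k : k < 5 -> attach c k <> attach c (k.+1 %% 5).
Proof.
rewrite /attach /pos /neg; case: k => [|[|[|[|[|k]]]]] //= _;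
  by case: (prem1 c); case: (prem2 c); case: (conc1 c); case: (conc2 c).
Qed.

Lemma adj_cyc c k w : adj (inr (c, k)) (inl w) = act c && (attach c k == w).
Proof. by rewrite /adj /=; case: w => [p|[x s]]; rewrite /= orbF. Qed.

(** By the number of cycle vertices: three would form a triangle in a 5-cycle; two are consecutive
    and attached to different vertices by [attach_succ]; one has a single neighbour outside its
    cycle; with none, only palette and literals remain. *)
Lemma adj_triangle u v w : adj u v -> adj v w -> adj w u -> False.
Proof.
have cycw c k d l w' : adj (inr (c, k)) (inr (d, l)) ->
    adj (inr (d, l)) (inl w') -> adj (inl w') (inr (c, k)) -> False.
  rewrite [adj (inl _) _]adj_sym !adj_cyc => + /andP[_ /eqP e1] /andP[_ /eqP e2].
  rewrite /adj /= => /orP[] /and3P[/eqP ecd h /eqP el].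
    by apply: (@attach_succ c k h); rewrite -el e2 ecd e1.
  by apply: (@attach_succ d l h); rewrite -el e1 ecd e2.
have cyc1 c k w1 w2 : adj (inr (c, k)) (inl w1) -> adj (inl w1) (inl w2) ->
    adj (inl w2) (inr (c, k)) -> False.
  rewrite [adj (inl w2) _]adj_sym !adj_cyc => /andP[_ /eqP <-] h /andP[_ /eqP e2].
  by move: h; rewrite e2 adj_irr.
case: u => [u|[c k]]; case: v => [v|[d l]]; case: w => [w|[b m]].
- case: u => [p|[x s]]; case: v => [q|[y s']]; case: w => [r|[z s'']]; rewrite /adj /= ?orbF.
  + exact: palette_triangle.
  + by case: s'' => h /eqP E1 /eqP E2; move: h; rewrite E1 E2.
  + by case: s' => /eqP E1 /eqP E2 h; move: h; rewrite E1 E2.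
  + by case: s'; case: s'' => /eqP -> + /eqP; rewrite ?andbF.
  + by case: s => /eqP -> h /eqP E; move: h; rewrite E.
  + by case: s; case: s'' => /eqP -> /eqP; rewrite ?andbF.
  + by case: s; case: s' => + /eqP -> /eqP; rewrite ?andbF.
  + by case: s; case: s'; case: s''; rewrite ?andbF.
- move=> h1 h2 h3; exact: (cyc1 b m u v).
- move=> h1 h2 h3; exact: (cyc1 d l w u).
- move=> h1 h2 h3; exact: (cycw d l b m u).
- move=> h1 h2 h3; exact: (cyc1 c k v w).
- move=> h1 h2 h3; exact: (cycw b m c k v).
- move=> h1 h2 h3; exact: (cycw c k d l w).
- rewrite /adj /= => /orP[] /and3P[/eqP -> h1 /eqP e1] /orP[] /and3P[/eqP -> h2 /eqP e2]
    /orP[] /and3P[_ h3 /eqP e3]; lia.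
Qed.

(** If the clause failed, all five attached vertices would have the colour of vertex 13, and the
    cycle would be an odd cycle avoiding it. [dom] selects the vertices actually present, since
    [vtx] is infinite. *)
Lemma sat_of_coloring (dom : pred vtx) (f : vtx -> nat) :
  (forall p, p < 15 -> dom (Pal p)) ->
  (forall u, dom u -> f u < 3) ->
  (forall u v, dom u -> dom v -> adj u v -> f u != f v) ->
  forall c, act c -> (forall k, k < 5 -> dom (Cyc c k)) ->
    (forall x, Some x \in [:: prem1 c; prem2 c; conc1 c; conc2 c] -> forall s, dom (Lit x s)) ->
    clause_holds (fun x => f (Lit x true) == f (Pal 11)) c.
Proof.
move=> domP f3 fadj c ac domC domX.
have fP p q : p < 15 -> q < 15 -> (p, q) \in palette_edges -> f (Pal p) != f (Pal q).
  by move=> hp hq h; apply: fadj; rewrite ?domP // /adj /= h.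
have E01 : f (Pal 0) = f (Pal 1).
  apply: (@groetzsch_minus_edge (fun p => f (Pal p))) => [p hp|p q h].
    by apply: f3; exact: domP.
  have hp := palette_lt h; have hq : q < 15 by apply: (@palette_lt q p); rewrite /pal_adj orbC.
  by apply: fadj; rewrite ?domP.
have b0 := f3 _ (domP 0 isT); have b11 := f3 _ (domP 11 isT).
have b12 := f3 _ (domP 12 isT); have b13 := f3 _ (domP 13 isT); have b14 := f3 _ (domP 14 isT).
have e1 := fP 11 0 isT isT isT; have e2 := fP 11 12 isT isT isT.
have e3 := fP 11 13 isT isT isT; have e4 := fP 11 14 isT isT isT.
have e5 := fP 12 1 isT isT isT; have e6 := fP 13 1 isT isT isT; have e7 := fP 14 1 isT isT isT.
have lit x : (forall s, dom (Lit x s)) -> [/\ f (Lit x true) < 3, f (Lit x false) < 3,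
    f (Lit x true) != f (Pal 0), f (Lit x false) != f (Pal 0) &
    f (Lit x true) != f (Lit x false)].
  move=> dx; rewrite !f3 //; split=> //.
  - by apply: fadj; rewrite ?domP.
  - by rewrite E01; apply: fadj; rewrite ?domP.
  - by apply: fadj; rewrite // /adj /= eqxx.
pose val x := f (Lit x true) == f (Pal 11).
rewrite /clause_holds -/val; apply: contraT; rewrite negb_imply negb_or.
move=> /andP[/andP[p1 p2] /andP[c1 c2]].
have negE o : oapp val true o -> (forall x, o = Some x -> forall s, dom (Lit x s)) ->
    dom (inl (neg o)) /\ f (inl (neg o)) = f (Pal 13).
  case: o => [x|] /=.
    move=> /eqP vx dx; have [] := lit x (dx x erefl) => ? ? ? ? ?.
    by split; [exact: (dx x erefl) | rewrite -/(Lit x false); lia].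
  by move=> _ _; split; [exact: domP | rewrite -/(Pal 14); lia].
have posE o : ~~ oapp val false o -> (forall x, o = Some x -> forall s, dom (Lit x s)) ->
    dom (inl (pos o)) /\ f (inl (pos o)) = f (Pal 13).
  case: o => [x|] /=.
    rewrite /val => vx dx; have [] := lit x (dx x erefl) => ? ? ? ? ?.
    by split; [exact: (dx x erefl) | rewrite -/(Lit x true); lia].
  by move=> _ _; split; [exact: domP | rewrite -/(Pal 12); lia].
have att k : k < 5 -> dom (inl (attach c k)) /\ f (inl (attach c k)) = f (Pal 13).
  case: k => [|[|[|[|k]]]] _ /=.
  - by apply: negE => // x E; apply: domX; rewrite !inE E eqxx.
  - by apply: posE => // x E; apply: domX; rewrite !inE E eqxx ?orbT.
  - by apply: negE => // x E; apply: domX; rewrite !inE E eqxx ?orbT.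
  - by apply: posE => // x E; apply: domX; rewrite !inE E eqxx ?orbT.
  - by split; first exact: domP.
have cyc k : k < 5 -> f (Cyc c k) < 3 /\ f (Cyc c k) != f (Pal 13).
  move=> hk; split; first exact/f3/domC.
  have [d1 <-] := att k hk; apply: fadj => //; first exact: domC.
  by rewrite adj_cyc ac eqxx.
have step k : k < 5 -> f (Cyc c k) != f (Cyc c (k.+1 %% 5)).
  move=> hk; apply: fadj; [exact: domC | by apply: domC; rewrite ltn_mod |].
  by rewrite /adj /= !eqxx hk.
have [??] := cyc 0 isT; have [??] := cyc 1 isT; have [??] := cyc 2 isT.
have [??] := cyc 3 isT; have [??] := cyc 4 isT.
have /= s0 := step 0 isT; have /= s1 := step 1 isT; have /= s2 := step 2 isT.
have /= s3 := step 3 isT; have /= s4 := step 4 isT.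
by exfalso; apply: (@odd_cycle (f (Pal 13)) (f (Cyc c 0)) (f (Cyc c 1)) (f (Cyc c 2)) (f (Cyc c 3)) (f (Cyc c 4))).
Qed.

(* The colour false (0) is used right before the colour true (1), at the last
   true literal; base (2) separates the rest. *)
Definition cycle_coloring (l0 l1 l2 l3 : bool) : seq nat :=
  if l3 then [:: 2; (~~ l1 : nat); 2; 0; 1]
  else if l2 then [:: (~~ l0 : nat); 2; 0; 1; 2]
  else if l1 then [:: 2; 0; 1; 2; 1]
  else [:: 0; 1; 2; 1; 2].

Definition free_cycle : seq nat := [:: 0; 1; 0; 1; 2].

Definition vtx_color (val : X -> bool) (u : vtx) : nat :=
  match u with
  | inl (inl p) => nth 0 palette_coloring p
  | inl (inr (x, s)) => val x == s
  | inr (c, k) =>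
      nth 0 (if act c then
               cycle_coloring (~~ oapp val true (prem1 c)) (oapp val false (conc1 c))
                 (~~ oapp val true (prem2 c)) (oapp val false (conc2 c))
             else free_cycle) k
  end.

Lemma vtx_color_lt val u : vtx_color val u < 3.
Proof.
have H s k : all (fun a => a < 3) s -> nth 0 s k < 3.
  move=> h; case: (ltnP k (size s)) => hk; last by rewrite nth_default.
  by have := allP h _ (mem_nth 0 hk).
case: u => [[p|[x s]]|[c k]] /=; first exact: H.
  by case: (_ == _).
apply: H; case: ifP => // _; rewrite /cycle_coloring.
by case: (oapp _ _ (prem1 c)); case: (oapp _ _ (prem2 c));
  case: (oapp _ _ (conc1 c)); case: (oapp _ _ (conc2 c)).
Qed.

Lemma coloring_of_sat val (ok : pred C) :
  (forall c, ok c -> act c -> clause_holds val c) ->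
  forall u v, (forall c k, u = Cyc c k -> ok c && (k < 5)) ->
    (forall c k, v = Cyc c k -> ok c && (k < 5)) ->
    adj u v -> vtx_color val u != vtx_color val v.
Proof.
move=> sat.
suff H u v : (forall c k, u = Cyc c k -> ok c && (k < 5)) ->
    (forall c k, v = Cyc c k -> ok c && (k < 5)) ->
    half_adj u v -> vtx_color val u != vtx_color val v.
  move=> u v hu hv /orP[h|h]; first exact: H.
  by rewrite eq_sym; exact: H.
have clause c k w : ok c -> k < 5 -> act c -> attach c k = w ->
    vtx_color val (Cyc c k) != vtx_color val (inl w).
  move=> okc hk ac <-; have := sat c okc ac.
  rewrite /clause_holds /= ac /attach /pos /neg /cycle_coloring.
  by case: k hk => [|[|[|[|[|k]]]]] //= _;
    case: (prem1 c) => [x1|]; case: (prem2 c) => [x2|];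
    case: (conc1 c) => [x3|]; case: (conc2 c) => [x4|] //=;
    try case: (val x1); try case: (val x2); try case: (val x3); try case: (val x4).
case: u => [[p|[x s]]|[c k]]; case: v => [[q|[y s']]|[d l]] // hu hv //.
- have H : all (fun e => nth 0 palette_coloring e.1 != nth 0 palette_coloring e.2) palette_edges by [].
  by move=> /(allP H).
- by move=> /= /eqP ->; case: s' {hv} => /=; case: (val y).
- by case/and3P => /eqP -> -> /=; case: s' {hv} => // _; case: (val y).
- have /andP[okc hk] := hu c k erefl => /= /andP[ac /eqP E].
  exact: clause okc hk ac E.
- have /andP[okc hk] := hu c k erefl => /= /andP[ac /eqP E].
  exact: clause okc hk ac E.
- have /andP[okc hk] := hu c k erefl => /= /and3P[/eqP <- _ /eqP ->].
  case: ifP => ac; last by case: k hk {hu} => [|[|[|[|[|k]]]]].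
  have := sat c okc ac; rewrite /clause_holds /cycle_coloring.
  by case: k hk {hu} => [|[|[|[|[|k]]]]] //= _;
    case: (oapp _ _ (prem1 c)); case: (oapp _ _ (prem2 c));
    case: (oapp _ _ (conc1 c)); case: (oapp _ _ (conc2 c)).
Qed.

End ClauseGraph.

(** * The computation tableau as a set of clauses *)

Section Tableau.
Variables (M : TM) (z0 : seq bool) (Zb N : nat).

Definition tvar : finType :=
  (tm_state M * option bool + bool * option bool + unit)%type.
(* Meaning of the variables at a pair [(t, i)]: at time [t] the control is in
   state [q] reading [h] (only [i = 0] matters); the cell number [i] on the right
   (iff [side]) of the head contains [s]; the input has a symbol number [i.+1].
   Cells are numbered from 0 on either side of the head, whence the shift. *)
Definition VQ (q : tm_state M) (h : option bool) : tvar := inl (inl (q, h)).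
Definition VC (side : bool) (s : option bool) : tvar := inl (inr (side, s)).
Definition VW : tvar := inr tt.

(** A halting state stays put, as in [step], so a row after the halting time still shows the final
    state. *)
Definition delta_total (q : tm_state M) (h : option bool) :=
  if tm_halt q then (q, h, MStay) else tm_delta q h.

Definition move_side (d : move) : option bool :=
  match d with MStay => None | MLeft => Some false | MRight => Some true end.

(* A reference is relative to the pair [(t, i)] of its clause: the time is [t] or
   [t.+1], and the number of the cell is [0], [i] or [i.+1]. *)
Definition ref := (bool * nat * tvar)%type.

Definition ref_at (t i : nat) (r : ref) : nat * nat * tvar :=
  let: (dt, ix, v) := r in (t + dt, nth 0 [:: 0; i; i.+1] ix, v).

(** Left summand: transitions, where kind [Some (false, _)] concerns the new control and the written
    symbol, and [Some (true, side)] carries the cells of one side over. Right summand: the initial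
    row, namely head, input cells, the blank left side, and four templates for the certificate and
    the blanks after it. *)
Definition template : finType :=
  (tm_state M * option bool * option bool * option (bool * bool) +
   (bool + bool + option (bool * bool)))%type.

Definition implication (p1 : option ref) (p2 : option ref) (c : ref) :=
  ((p1, p2), (Some c, Some c)).

(* The tape moves under the head: the written symbol ends up on the side opposite
   to the move, and the new head symbol comes from the side of the move.  Kind
   [None] forbids halting in a rejecting state.  In the initial row, the cells of
   the certificate are constrained through the free variables [VW]. *)
Definition template_body (tm : template) :
    (option ref * option ref) * (option ref * option ref) :=
  match tm with
  | inl (q, h, s, kind) =>
      let now : ref := (false, 0, VQ q h) in
      let: (q', w, d) := delta_total q h in
      match kind, move_side d with
      | None, _ =>
          ((Some now, None),
           (if tm_halt q && ~~ tm_accept q then None else Some now, None))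
      | Some (false, _), None => implication (Some now) None (true, 0, VQ q' w)
      | Some (false, false), Some dir => implication (Some now) None (true, 0, VC (~~ dir) w)
      | Some (false, true), Some dir =>
          implication (Some now) (Some (false, 0, VC dir s)) (true, 0, VQ q' s)
      | Some (true, side), None =>
          implication (Some now) (Some (false, 1, VC side s)) (true, 1, VC side s)
      | Some (true, side), Some dir =>
          if side == dir
          then implication (Some now) (Some (false, 2, VC side s)) (true, 1, VC side s)
          else implication (Some now) (Some (false, 1, VC side s)) (true, 2, VC side s)
      end
  | inr (inl (inl b)) => implication None None (false, 0, VQ (tm_start M) (Some b))
  | inr (inl (inr b)) => implication None None (false, 1, VC true (Some b))
  | inr (inr None) => implication None None (false, 1, VC false None)
  | inr (inr (Some (false, false))) =>
      ((Some (false, 1, VW), None),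
       (Some (false, 1, VC true (Some true)), Some (false, 1, VC true (Some false))))
  | inr (inr (Some (false, true))) =>
      ((None, None), (Some (false, 1, VW), Some (false, 1, VC true None)))
  | inr (inr (Some (true, false))) => implication (Some (false, 2, VW)) None (false, 1, VW)
  | inr (inr (Some (true, true))) => implication None None (false, 1, VC true None)
  end.

(** An inactive clause keeps its 5-cycle, detached from all else, so the vertices depend on [N]
    alone. The guards [t.+1 < N] and [i.+1 < N] keep all references inside the table. *)
Definition active (c : nat * nat * template) : bool :=
  let: (t, i, tm) := c in
  match tm with
  | inl (_, _, _, None) => true
  | inl (_, _, _, Some _) => (t.+1 < N) && (i.+1 < N)
  | inr (inl (inl b)) => [&& t == 0, i == 0 & nth false z0 0 == b]
  | inr (inl (inr b)) => [&& t == 0, i.+1 < size z0 & nth false z0 i.+1 == b]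
  | inr (inr None) => t == 0
  | inr (inr (Some (false, _))) => [&& t == 0, size z0 <= i.+1 & i.+1 < Zb]
  | inr (inr (Some (true, false))) => (t == 0) && (i.+1 < N)
  | inr (inr (Some (true, true))) => (t == 0) && (Zb <= i.+1)
  end.

Definition at_clause (pick : template -> option ref) (c : nat * nat * template) :=
  let: (t, i, tm) := c in omap (ref_at t i) (pick tm).

Definition tprem1 := at_clause (fun tm => (template_body tm).1.1).
Definition tprem2 := at_clause (fun tm => (template_body tm).1.2).
Definition tconc1 := at_clause (fun tm => (template_body tm).2.1).
Definition tconc2 := at_clause (fun tm => (template_body tm).2.2).

Definition tholds := clause_holds tprem1 tprem2 tconc1 tconc2.

Definition cell (c : config M) (side : bool) (i : nat) : option bool :=
  nth None (if side then cf_right c else cf_left c) i.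

Lemma step_spec (c : config M) q' w d :
  delta_total (cf_state c) (cf_head c) = (q', w, d) ->
  cf_state (step c) = q' /\
  match move_side d with
  | None => cf_head (step c) = w /\ forall side i, cell (step c) side i = cell c side i
  | Some dir =>
      [/\ cf_head (step c) = cell c dir 0, cell (step c) (~~ dir) 0 = w,
          forall i, cell (step c) (~~ dir) i.+1 = cell c (~~ dir) i &
          forall i, cell (step c) dir i = cell c dir i.+1]
  end.
Proof.
case: c => q l h r; rewrite /delta_total /step /=.
case: ifP => hq; first by case=> <- <- <-.
move=> ->; case: d => /=.
- by case: l => [|a l] /=; split=> //; split=> // i; rewrite /cell /= nth_nil.
- by case: r => [|a r] /=; split=> //; split=> // i; rewrite /cell /= nth_nil.
- by [].
Qed.

(** * From a satisfying valuation to an accepted certificate *)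

Section Soundness.
Variable val : nat * nat * tvar -> bool.
Hypotheses (z0_gt0 : 0 < size z0) (z0_le : size z0 <= Zb) (Zb_le : Zb <= N).
Hypothesis val_sat : forall t i tm, t < N -> i < N -> active (t, i, tm) -> tholds val (t, i, tm).

(** Certificate symbol [j] is symbol [size z0 + j] of the input, hence in cell [(size z0).-1 + j] to
    the right of the head. *)
Let Y i := (size z0).-1 + i.

Definition guess_len : nat :=
  find (fun j => ~~ val (0, Y j, VW)) (iota 0 (Zb - size z0)).

Definition guess : seq bool :=
  mkseq (fun j => val (0, Y j, VC true (Some true))) guess_len.

Lemma size_guess : size z0 + size guess <= Zb.
Proof.
rewrite size_mkseq; have := find_size (fun j => ~~ val (0, Y j, VW)) (iota 0 (Zb - size z0)).
by rewrite size_iota -/guess_len; clear -z0_le; lia.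
Qed.

(** The clauses [VW] at [i.+1] implies [VW] at [i] make the occupied cells an initial segment, so
    the first failure of [VW] is the length of the certificate. *)
Lemma guess_false j : guess_len <= j -> j < Zb - size z0 -> ~~ val (0, Y j, VW).
Proof.
elim: j => [|j IH].
  rewrite leqn0 => /eqP E h.
  have hh : has (fun j => ~~ val (0, Y j, VW)) (iota 0 (Zb - size z0)).
    by rewrite has_find size_iota -/guess_len E.
  by have := nth_find 0 hh; rewrite -/guess_len E nth_iota.
rewrite leq_eqVlt => /orP[/eqP E|lt] h.
  have hh : has (fun j => ~~ val (0, Y j, VW)) (iota 0 (Zb - size z0)).
    by rewrite has_find size_iota -/guess_len E.
  by have := nth_find 0 hh; rewrite -/guess_len E nth_iota.
have := IH lt (ltnW h); apply: contra => hS.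
have := @val_sat 0 (Y j) (inr (inr (Some (true, false)))).
rewrite /tholds /clause_holds /= orbb /Y -addnS -/(Y _) hS; apply; rewrite /Y; lia.
Qed.

Lemma row0_cell i : i < N ->
  val (0, i, VC true (nth None (map Some (behead (z0 ++ guess))) i)).
Proof.
move=> hi.
have N_gt0 : 0 < N by lia.
have -> : nth None (map Some (behead (z0 ++ guess))) i =
   nth None (map Some z0 ++ map Some guess) i.+1 by rewrite -map_cat; case: (z0) z0_gt0.
rewrite nth_cat size_map; case: ltnP => h1.
  rewrite (nth_map false) //.
  have := @val_sat 0 i (inr (inl (inr (nth false z0 i.+1)))) N_gt0 hi.
  by rewrite /tholds /clause_holds /= h1 eqxx orbb; apply.
case: (ltnP i.+1 Zb) => h2; last first.
  rewrite nth_default; last by rewrite size_map; have := size_guess; lia.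
  have := @val_sat 0 i (inr (inr (Some (true, true)))) N_gt0 hi.
  by rewrite /tholds /clause_holds /= orbb; apply.
set j := i.+1 - size z0.
have Ei : i = Y j by rewrite /Y /j; lia.
have act tm : tm = (false, false) \/ tm = (false, true) ->
    active (0, i, inr (inr (Some tm))) by case=> ->; rewrite /= h1 h2.
case: (ltnP j guess_len) => hj.
  rewrite (nth_map false) ?size_mkseq // nth_mkseq // -Ei.
  have Wj : val (0, i, VW).
    have := before_find 0 hj; rewrite nth_iota; last by rewrite /j; lia.
    by rewrite add0n -Ei => /negbFE.
  have := @val_sat 0 i _ N_gt0 hi (act _ (or_introl erefl)).
  by rewrite /tholds /clause_holds /= Wj /=; case E: (val (0, i, VC true (Some true))).
rewrite nth_default; last by rewrite size_map size_mkseq.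
have /negbTE Wj : ~~ val (0, i, VW) by rewrite Ei guess_false // /j; lia.
have := @val_sat 0 i _ N_gt0 hi (act _ (or_intror erefl)).
by rewrite /tholds /clause_holds /= Wj.
Qed.

Let c t := run t (init M (z0 ++ guess)).

(** Cell [i] at time [t.+1] may come from cell [i.+1] at time [t], so each step loses one cell:
    hence [t + i < N]. [val] may make further variables true; the implications still force those of
    the run. *)
Lemma tableau_true t : t < N ->
  val (t, 0, VQ (cf_state (c t)) (cf_head (c t))) /\
  forall side i, t + i < N -> val (t, i, VC side (cell (c t) side i)).
Proof.
elim: t => [|t IH] ht.
  have N_gt0 : 0 < N by lia.
  split.
    have := @val_sat 0 0 (inr (inl (inl (nth false z0 0)))) N_gt0 N_gt0.
    rewrite /tholds /clause_holds /= eqxx orbb => /(_ isT).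
    by rewrite /c /=; case: (z0) z0_gt0.
  move=> side i hi; case: side.
    have := @row0_cell i hi; rewrite /c /cell /=.
    by case: (z0) z0_gt0.
  have := @val_sat 0 i (inr (inr None)) N_gt0 hi.
  rewrite /tholds /clause_holds /= orbb => /(_ isT).
  by rewrite /c /cell /=; case: (z0) z0_gt0 => //= *; rewrite nth_nil.
have [IHq IHc] := IH (ltnW ht).
case Ed: (delta_total (cf_state (c t)) (cf_head (c t))) => [[q' w] d].
have := step_spec Ed; rewrite -[step (c t)]/(c t.+1) => -[-> ].
have use s kind i : i.+1 < N -> tholds val (t, i,
    inl (cf_state (c t), cf_head (c t), s, Some kind)).
  by move=> hi; apply: val_sat; rewrite /= ?ht; lia.
have N_gt1 : 1 < N by lia.
case Em: (move_side d) => [dir|].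
  move=> [-> Ew En Ef]; split.
    have := use (cell (c t) dir 0) (false, true) 0 N_gt1.
    rewrite /tholds /clause_holds /= Ed Em /= addn0 addn1 IHq /= orbb.
    by rewrite IHc ?addn0; [apply | lia].
  move=> side i; have [->|] := eqVneq side dir.
    move=> hi; rewrite Ef.
    have := use (cell (c t) dir i.+1) (true, dir) i.
    rewrite /tholds /clause_holds /= Ed Em eqxx /= addn0 addn1 IHq /= orbb.
    by rewrite IHc; [move=> /= H; apply: H; lia | lia].
  move=> ne; have -> : side = ~~ dir by case: side dir ne {Em En Ef Ew} => [] [].
  case: i => [|i] hi.
    rewrite Ew; have := use None (false, false) 0 N_gt1.
    by rewrite /tholds /clause_holds /= Ed Em /= addn0 addn1 IHq /= orbb.
  rewrite En; have := use (cell (c t) (~~ dir) i) (true, ~~ dir) i.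
  rewrite /tholds /clause_holds /= Ed Em.
  have -> : (~~ dir == dir) = false by case: (dir).
  rewrite /= addn0 addn1 IHq /= orbb.
  by rewrite IHc; [move=> /= H; apply: H; lia | lia].
move=> [-> Ec]; split.
  have := use None (false, false) 0 N_gt1.
  by rewrite /tholds /clause_holds /= Ed Em /= addn0 addn1 IHq /= orbb.
move=> side i hi; rewrite Ec; have := use (cell (c t) side i) (true, side) i.
rewrite /tholds /clause_holds /= Ed Em /= addn0 addn1 IHq /= orbb.
by rewrite IHc; [move=> /= H; apply: H; lia | lia].
Qed.

Lemma tableau_accepts T : T < N -> halted (c T) -> tm_accept (cf_state (c T)).
Proof.
move=> T_lt hc; have [Hq _] := tableau_true T_lt.
apply: contraT => na.
have := @val_sat T 0 (inl (cf_state (c T), cf_head (c T), None, None)) T_lt.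
rewrite /tholds /clause_holds /=; case: (delta_total _ _) => [[q' w] d] /=.
by rewrite -/(halted (c T)) hc na /= addn0 Hq /= => H; apply: H; lia.
Qed.

End Soundness.

(** * From an accepting run to a satisfying valuation *)

Section Completeness.
Variables (y : seq bool) (t0 : nat).
Hypothesis z0_gt0 : 0 < size z0.
Hypothesis y_le : size z0 + size y <= Zb.
Let c t := run t (init M (z0 ++ y)).
Hypothesis halt0 : halted (c t0).
Hypothesis acc0 : tm_accept (cf_state (c t0)).

Definition run_val (x : nat * nat * tvar) : bool :=
  let: (t, i, v) := x in
  match v with
  | inl (inl (q, h)) => (cf_state (c t) == q) && (cf_head (c t) == h)
  | inl (inr (side, s)) => cell (c t) side i == s
  | inr _ => i.+1 < size (z0 ++ y)
  end.

Lemma run_halted t s : halted (c t) -> t <= s -> c s = c t.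
Proof.
move=> h /subnK <-; elim: (s - t) => [|k IH] //.
rewrite -[c (k.+1 + t)]/(step (c (k + t))) IH.
by move: h; rewrite /halted; case: (c t) => q l hd r /= ->.
Qed.

(** A halted configuration never changes, so every halted configuration of the run is the accepting
    one; this satisfies the clauses against rejection. *)
Lemma halted_accepts t : halted (c t) -> tm_accept (cf_state (c t)).
Proof.
move=> h; case: (leqP t t0) => lt; first by rewrite -(run_halted h lt).
by rewrite (run_halted halt0 (ltnW lt)).
Qed.

Lemma start0 : (cf_state (init M (z0 ++ y)) = tm_start M) *
  (cf_head (init M (z0 ++ y)) = Some (nth false z0 0)).
Proof. by case: (z0) z0_gt0. Qed.

Lemma cell_right0 i :
  cell (init M (z0 ++ y)) true i = nth None (map Some z0 ++ map Some y) i.+1.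
Proof. by rewrite /cell; case: (z0) z0_gt0 => //= b l _; rewrite map_cat. Qed.

Lemma run_val_sat t i tm : active (t, i, tm) -> tholds run_val (t, i, tm).
Proof.
case: tm => [[[[q h] s] kind]|[[b|b]|[[[] []]|]]].
- rewrite /tholds /clause_holds /=.
  (* Unless the template speaks of the actual state and head symbol, its first premise is false. *)
  have [[Eq Eh]|ne] : cf_state (c t) = q /\ cf_head (c t) = h \/
      (cf_state (c t) == q) && (cf_head (c t) == h) = false.
  + have [->|] := eqVneq (cf_state (c t)) q; last by right.
    by have [->|] := eqVneq (cf_head (c t)) h; [left | right].
  + case Ed: (delta_total q h) => [[q' w] d].
    have := Ed; rewrite -{1}Eq -{1}Eh => /step_spec; rewrite -[step (c t)]/(c t.+1).
    case: kind => [[ck side]|] /=; last first.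
      rewrite addn0 Eq Eh !eqxx /= orbF => _ _.
      case: ifP => /= [/andP[hq]|_]; last by rewrite addn0 Eq Eh !eqxx.
      by rewrite -Eq halted_accepts // /halted Eq.
    move=> [Eq']; case: (move_side d) => [dir|] H _; case: ck.
    * case: H => _ _ H1 H2; case: eqP => [->|ne] /=; rewrite addn0 addn1 orbb.
        by rewrite H2; apply/implyP => /andP[].
      have -> : side = ~~ dir by case: side dir ne {H1 H2} => [] [].
      by rewrite H1; apply/implyP => /andP[].
    * case: H => H1 H2 _ _; case: side => /=; rewrite addn1 orbb ?addn0.
        by rewrite Eq' H1 eqxx /=; apply/implyP => /andP[].
      by rewrite H2 eqxx implybT.
    * case: H => _ H; rewrite /= addn0 addn1 orbb H.
      by apply/implyP => /andP[].
    * by case: H => H _; case: side => /=; rewrite addn1 Eq' H !eqxx implybT.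
  + case: (delta_total q h) => [[q' w] d].
    by case: kind => [[[] []]|] /=; case: (move_side d) => [[]|] /=; rewrite /= ?addn0 ne.
- move=> /and3P[/eqP -> /eqP -> /eqP <-].
  by rewrite /tholds /clause_holds /= orbb !start0 !eqxx.
- move=> /and3P[/eqP -> hi /eqP <-].
  rewrite /tholds /clause_holds /= orbb cell_right0 nth_cat size_map hi.
  by rewrite (nth_map false).
- move=> /andP[/eqP -> hi].
  by rewrite /tholds /clause_holds /= orbb cell_right0 -map_cat nth_default // size_map size_cat; lia.
- move=> _; rewrite /tholds /clause_holds /= orbb.
  by apply/implyP; rewrite andbT; lia.
- move=> /and3P[/eqP -> _ _]; rewrite /tholds /clause_holds /= cell_right0 -map_cat.
  by case: ltnP => // h; rewrite nth_default // size_map.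
- move=> /and3P[/eqP -> _ _]; rewrite /tholds /clause_holds /= cell_right0 -map_cat andbT.
  by apply/implyP => h; rewrite (nth_map false) //; case: nth.
- move=> /eqP ->; rewrite /tholds /clause_holds /= orbb.
  by rewrite /cell; case: (z0 ++ y) => [|b l] /=; rewrite nth_nil.
Qed.

End Completeness.
End Tableau.

(** * The graph of a tableau *)

Section TableauGraph.
Variables (M : TM) (z0 : seq bool) (Zb N : nat).

Definition tnode : eqType := vtx (nat * nat * tvar M)%type (nat * nat * template M)%type.

(** The label of a vertex apart from its pair [(t, i)]. All pairs carry the same labels, so two
    loops over [N] around a fixed sequence enumerate the graph. *)
Definition loc : eqType := (tvar M * bool + template M * nat)%type.

Definition locs : seq loc :=
  [seq inl (v, s) | v <- enum (tvar M), s <- [:: true; false]] ++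
  [seq inr (tm, k) | tm <- enum (template M), k <- iota 0 5].

Definition place (t i : nat) (l : loc) : tnode :=
  match l with
  | inl (v, s) => Lit _ (t, i, v) s
  | inr (tm, k) => Cyc _ (t, i, tm) k
  end.

Definition nodes : seq tnode :=
  [seq Pal _ _ p | p <- iota 0 15] ++
  flatten [seq flatten [seq [seq place t i l | l <- locs] | i <- iota 0 N] | t <- iota 0 N].

Definition tadj : rel tnode :=
  adj (active z0 Zb N) (@tprem1 M) (@tprem2 M) (@tconc1 M) (@tconc2 M).

Definition tedge : rel 'I_(size nodes) :=
  fun i j => tadj (nth (Pal _ _ 0) nodes i) (nth (Pal _ _ 0) nodes j).

Lemma mem_place t i l : t < N -> i < N -> l \in locs -> place t i l \in nodes.
Proof.
move=> ht hi hl; rewrite mem_cat; apply/orP; right.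
apply/flattenP; exists (flatten [seq [seq place t j l' | l' <- locs] | j <- iota 0 N]).
  by apply/mapP; exists t; rewrite ?mem_iota.
apply/flattenP; exists [seq place t i l' | l' <- locs]; last exact: map_f.
by apply/mapP; exists i; rewrite ?mem_iota.
Qed.

Lemma mem_pal p : p < 15 -> Pal _ _ p \in nodes.
Proof. by move=> hp; rewrite mem_cat map_f // mem_iota. Qed.

Lemma mem_lit t i v s : t < N -> i < N -> Lit _ (t, i, v) s \in nodes.
Proof.
move=> ht hi; apply: (@mem_place t i (inl (v, s))) => //.
rewrite mem_cat; apply/orP; left; apply/allpairsP; exists (v, s) => /=.
by rewrite mem_enum !inE; case: s.
Qed.

Lemma mem_cyc t i tm k : t < N -> i < N -> k < 5 -> Cyc _ (t, i, tm) k \in nodes.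
Proof.
move=> ht hi hk; apply: (@mem_place t i (inr (tm, k))) => //.
rewrite mem_cat; apply/orP; right; apply/allpairsP; exists (tm, k).
by rewrite mem_enum mem_iota.
Qed.

Lemma mem_cyc_inv t i tm k : Cyc _ (t, i, tm) k \in nodes -> (t < N) && (i < N) && (k < 5).
Proof.
rewrite mem_cat => /orP[/mapP[p _ //]|].
case/flattenP => s /mapP[t' ht' ->] /flattenP[s' /mapP[i' hi' ->]] /mapP[l hl].
rewrite !mem_iota !add0n /= in ht' hi'.
case: l hl => [[v b] _ //|[tm' k']] hl [-> -> _ ->].
rewrite ht' hi' /=; move: hl; rewrite mem_cat => /orP[/allpairsP[[a b] [_ _ //]]|].
by case/allpairsP => [[a b] [_ hb [_ ->]]]; rewrite mem_iota in hb.
Qed.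

Lemma tedge_sym : symmetric tedge.
Proof. by move=> i j; exact: adj_sym. Qed.

Lemma tedge_irr : irreflexive tedge.
Proof. by move=> i; exact: adj_irr. Qed.

Lemma tedge_triangle_free : triangle_free tedge.
Proof.
move=> K /forall_inP cK; rewrite ltnNge; apply/negP => /card_gt2P.
move=> [i [j [k [[iK jK kK] [nij njk nki]]]]].
have adjK a b : a \in K -> b \in K -> a != b -> tedge a b.
  by move=> aK bK nab; have /forall_inP/(_ b bK)/implyP := cK a aK; apply.
exact: (adj_triangle (adjK i j iK jK nij) (adjK j k jK kK njk) (adjK k i kK iK nki)).
Qed.

Lemma three_colorable_sat :
  three_colorable tedge <->
  exists val, forall t i (tm : template M), t < N -> i < N -> active z0 Zb N (t, i, tm) ->
    tholds val (t, i, tm).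
Proof.
have idx u : u \in nodes -> index u nodes < size nodes by rewrite index_mem.
split=> [[f [f3 fadj]]|[val H]].
  (* The colouring is carried over from indices to vertices; outside [nodes] the value 0 is a mere
     default. *)
  pose g (u : tnode) := oapp f 0 (insub (index u nodes)).
  have gE u (hu : u \in nodes) : g u = f (Ordinal (idx u hu)).
    by rewrite /g (insubT (fun k => k < size nodes) (idx u hu)).
  exists (fun x => g (Lit _ x true) == g (Pal _ _ 11)) => t i tm ht hi ac.
  apply: (@sat_of_coloring _ _ (active z0 Zb N) _ _ _ _ (mem nodes)) => //.
  - exact: mem_pal.
  - by move=> u hu; rewrite gE.
  - move=> u v hu hv uv; rewrite !gE; apply: fadj.
    by rewrite /tedge /= !nth_index.
  - by move=> k hk; exact: mem_cyc.
  - move=> x hx s.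
    (* The guards in [active] keep every pair that the clause refers to inside the table. *)
    suff /andP[h1 h2] : (x.1.1 < N) && (x.1.2 < N).
      by case: x h1 h2 {hx} => [[t' i'] v] /=; exact: mem_lit.
    have N0 : 0 < N by lia.
    move: hx ac; rewrite !inE -!(eq_sym _ (Some x)) => /or4P[] /eqP;
      rewrite /tprem1 /tprem2 /tconc1 /tconc2 /at_clause;
      case: tm => [[[[q h] s'] [[[] []]|]]|[[b|b]|[[[] []]|]]] //=;
      try (case: (delta_total q h) => [[q' w] d]; case: (move_side d) => [[]|] //=);
      try case: ifP => //= _;
      try (by case=> <- /=; lia).
exists (fun i : 'I_(size nodes) => vtx_color (active z0 Zb N) (@tprem1 M) (@tprem2 M) (@tconc1 M)
  (@tconc2 M) val (nth (Pal _ _ 0) nodes i)).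
split=> [i|i j]; first exact: vtx_color_lt.
apply: (@coloring_of_sat _ _ _ _ _ _ _ val
  (fun c => (c.1.1 < N) && (c.1.2 < N))).
- by move=> [[t i'] tm] /andP[]; exact: H.
- move=> [[t i'] tm] k E; apply: (@mem_cyc_inv t i' tm k).
  by rewrite -E mem_nth.
- move=> [[t i'] tm] k E; apply: (@mem_cyc_inv t i' tm k).
  by rewrite -E mem_nth.
Qed.

End TableauGraph.

(** * Printing unary numbers *)

Definition pseq (ps : seq prog) : prog := foldr PSeq PSkip ps.

Lemma out_pseq env ps : out env (pseq ps) = flatten [seq out env p | p <- ps].
Proof. by elim: ps => //= p ps ->. Qed.

Definition ptrue : prog := POut (FConst true).

Lemma flatten_nseq_true n m : flatten (nseq n (nseq m true)) = nseq (n * m) true.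
Proof. by elim: n => //= n ->; rewrite -nseqD. Qed.

Lemma out_repeat env c p n :
  out env p = nseq n true -> out env (pseq (nseq c p)) = nseq (c * n) true.
Proof. by move=> H; rewrite out_pseq map_nseq H flatten_nseq_true. Qed.

Lemma map_const (A B : Type) (c : B) (s : seq A) : [seq c | _ <- s] = nseq (size s) c.
Proof. by elim: s => //= a s ->. Qed.

Lemma out_power env s k : s < size env ->
  out env (iter k (PFor s) ptrue) = nseq (size (nth [::] env s) ^ k) true.
Proof.
elim: k env => [|k IH] env hs //=.
rewrite (eq_map (g := fun=> nseq (size (nth [::] env s) ^ k) true)); last first.
  by move=> i /=; rewrite IH ?size_rcons ?nth_rcons ?hs // ltnW.
by rewrite map_const size_iota expnS flatten_nseq_true.
Qed.

Lemma out_unary env s : s < size env ->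
  out env (PFor s ptrue) = nseq (size (nth [::] env s)) true.
Proof. by move=> hs; rewrite -(out_power 1 hs) ?expn1. Qed.

(** * The program printing the graph *)

(* Levels of the strings computed before the graph is printed: 1 is the fixed
   part of the input of the verifier, 2 its length, 3 the bound on the length
   of the whole input, 4 the size of the tableau.  Level 10 is never bound and
   hence stands for the empty string, i.e. the counter 0. *)
Definition f_lt (i j : nat) : fm := FLook j i false.
Definition f_slt (i j : nat) : fm := FLook j i true.
Definition f_zero (i : nat) : fm := FNot (f_lt 10 i).
Definition f_eq (i j : nat) : fm := FAnd (FNot (f_lt i j)) (FNot (f_lt j i)).
Definition f_succ (i j : nat) : fm := FAnd (f_lt i j) (FNot (f_slt i j)).
Definition f_or (f g : fm) : fm := FNot (FAnd (FNot f) (FNot g)).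
Definition f_bit (b : bool) (f : fm) : fm := if b then f else FNot f.

Definition unary (env : seq (seq bool)) (j : nat) : Prop :=
  nth [::] env j = nseq (size (nth [::] env j)) true.

Definition cval (env : seq (seq bool)) (j : nat) : nat := size (nth [::] env j).

Lemma nth_nseq_true n i : nth false (nseq n true) i = (i < n).
Proof. by rewrite nth_nseq; case: ifP. Qed.

Section Formulas.
Variable env : seq (seq bool).

Lemma f_ltE i j : unary env j -> feval env (f_lt i j) = (cval env i < cval env j).
Proof. by move=> /= ->; rewrite nth_nseq_true addn0. Qed.

Lemma f_sltE i j : unary env j -> feval env (f_slt i j) = ((cval env i).+1 < cval env j).
Proof. by move=> /= ->; rewrite nth_nseq_true addn1. Qed.

Lemma fevalN f : feval env (FNot f) = ~~ feval env f. Proof. by []. Qed.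

Lemma fevalA f g : feval env (FAnd f g) = feval env f && feval env g. Proof. by []. Qed.

Lemma fevalC b : feval env (FConst b) = b. Proof. by []. Qed.

Lemma f_zeroE i : unary env i -> nth [::] env 10 = [::] ->
  feval env (f_zero i) = (cval env i == 0).
Proof. by move=> u E; rewrite fevalN f_ltE // /cval E lt0n negbK. Qed.

Lemma f_eqE i j : unary env i -> unary env j ->
  feval env (f_eq i j) = (cval env i == cval env j).
Proof. by move=> ui uj; rewrite fevalA !fevalN !f_ltE //; lia. Qed.

Lemma f_succE i j : unary env j ->
  feval env (f_succ i j) = (cval env j == (cval env i).+1).
Proof. by move=> uj; rewrite fevalA fevalN f_ltE // f_sltE //; lia. Qed.

Lemma f_orE f g : feval env (f_or f g) = feval env f || feval env g.
Proof. by rewrite /= negb_and !negbK. Qed.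

Lemma f_bitE b f : feval env (f_bit b f) = (feval env f == b).
Proof. by case: b => /=; case: feval. Qed.

End Formulas.

Section GraphProgram.
Variable M : TM.

(** A vertex as the printing program sees it: [t] and [i] are levels of loop counters, not values,
    whereas the label is known when the program is written. *)
Inductive vterm := TPal of nat | TLoc of nat & nat & loc M.

Definition f_active (t i : nat) (tm : template M) : fm :=
  match tm with
  | inl (_, _, _, None) => FConst true
  | inl (_, _, _, Some _) => FAnd (f_slt t 4) (f_slt i 4)
  | inr (inl (inl b)) => FAnd (f_zero t) (FAnd (f_zero i) (f_bit b (FLook 1 10 false)))
  | inr (inl (inr b)) => FAnd (f_zero t) (FAnd (f_slt i 2) (f_bit b (FLook 1 i true)))
  | inr (inr None) => f_zero t
  | inr (inr (Some (false, _))) => FAnd (f_zero t) (FAnd (FNot (f_slt i 2)) (f_slt i 3))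
  | inr (inr (Some (true, false))) => FAnd (f_zero t) (f_slt i 4)
  | inr (inr (Some (true, true))) => FAnd (f_zero t) (FNot (f_slt i 3))
  end.

(** [attach] with templates as clauses and relative references as variables, so that its value is
    available before the counters are. *)
Definition template_attach : template M -> nat -> nat + ref M * bool :=
  attach (fun tm => (template_body tm).1.1) (fun tm => (template_body tm).1.2)
         (fun tm => (template_body tm).2.1) (fun tm => (template_body tm).2.2).

Definition f_ref (t i t' i' : nat) (v : tvar M) (r : ref M) : fm :=
  let: (dt, ix, v') := r in
  FAnd (FConst (v' == v)) (FAnd (if dt then f_succ t t' else f_eq t t')
    (match ix with 1 => f_eq i i' | 2 => f_succ i i' | _ => f_zero i' end)).

Definition f_arc (u v : vterm) : fm :=
  match u, v with
  | TPal p, TPal q => FConst ((p, q) \in palette_edges)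
  | TPal p, TLoc _ _ (inl (_, s)) => FConst (p == ~~ s)
  | TLoc t i (inl (x, s)), TLoc t' i' (inl (y, s')) =>
      FAnd (FConst [&& x == y, s & ~~ s']) (FAnd (f_eq t t') (f_eq i i'))
  | TLoc t i (inr (tm, k)), TLoc t' i' (inr (tm', l)) =>
      FAnd (FConst [&& tm == tm', k < 5 & l == k.+1 %% 5]) (FAnd (f_eq t t') (f_eq i i'))
  | TLoc t i (inr (tm, k)), TPal p =>
      FAnd (f_active t i tm) (FConst (if template_attach tm k is inl q then q == p else false))
  | TLoc t i (inr (tm, k)), TLoc t' i' (inl (v, s)) =>
      FAnd (f_active t i tm)
        (if template_attach tm k is inr (r, s') then FAnd (FConst (s' == s)) (f_ref t i t' i' v r)
         else FConst false)
  | _, _ => FConst false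
  end.

Definition f_adj (u v : vterm) : fm := f_or (f_arc u v) (f_arc v u).

Section Correctness.
Variables (z0 : seq bool) (Zb N : nat) (env : seq (seq bool)).
Hypotheses (env1 : nth [::] env 1 = z0) (env2 : nth [::] env 2 = nseq (size z0) true).
Hypotheses (env3 : nth [::] env 3 = nseq Zb true) (env4 : nth [::] env 4 = nseq N true).
Hypothesis env10 : nth [::] env 10 = [::].

Definition node_of (u : vterm) : tnode M :=
  match u with
  | TPal p => Pal _ _ p
  | TLoc t i l => place (cval env t) (cval env i) l
  end.

Definition counters (u : vterm) : Prop :=
  if u is TLoc t i _ then unary env t /\ unary env i else True.

Lemma f_activeE t i tm : unary env t -> unary env i ->
  feval env (f_active t i tm) = active z0 Zb N (cval env t, cval env i, tm).
Proof.
move=> ut ui.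
have u2 : unary env 2 by rewrite /unary env2 size_nseq.
have u3 : unary env 3 by rewrite /unary env3 size_nseq.
have u4 : unary env 4 by rewrite /unary env4 size_nseq.
have c2 : cval env 2 = size z0 by rewrite /cval env2 size_nseq.
have c3 : cval env 3 = Zb by rewrite /cval env3 size_nseq.
have c4 : cval env 4 = N by rewrite /cval env4 size_nseq.
case: tm => [[[[q h] s] [k|]]|[[b|b]|[[[] []]|]]] //;
  rewrite /f_active ?fevalA ?fevalA ?f_zeroE ?f_zeroE ?fevalN ?f_sltE ?f_sltE ?f_bitE ?c2 ?c3 ?c4 //
    -?leqNgt //.
- by rewrite [feval _ _]/= env1 env10.
- by rewrite [feval _ _]/= env1 addn1.
Qed.

Lemma f_refE t i t' i' (v : tvar M) (s : bool) (r : ref M) (s' : bool) : unary env t -> unary env i -> unary env t' -> unary env i' ->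
  feval env (FAnd (FConst (s' == s)) (f_ref t i t' i' v r)) =
  ((ref_at (cval env t) (cval env i) r, s') == (cval env t', cval env i', v, s)).
Proof.
move=> ut ui ut' ui'; case: r => [[dt ix] w]; rewrite fevalA fevalC /f_ref !fevalA fevalC.
rewrite !xpair_eqE [RHS]andbC; congr andb; rewrite [RHS]andbC; congr andb; congr andb.
  by case: dt; rewrite ?f_succE ?f_eqE ?addn0 ?addn1 // eq_sym.
case: ix => [|[|[|ix]]]; rewrite ?f_succE ?f_eqE ?f_zeroE //= 1?eq_sym //.
by rewrite nth_nil eq_sym.
Qed.

Lemma f_arcE u v : counters u -> counters v ->
  feval env (f_arc u v) =
  half_adj (active z0 Zb N) (@tprem1 M) (@tprem2 M) (@tconc1 M) (@tconc2 M) (node_of u) (node_of v).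
Proof.
have att t i tm k :
    attach (@tprem1 M) (@tprem2 M) (@tconc1 M) (@tconc2 M) (t, i, tm) k =
    match template_attach tm k with
    | inl p => inl p
    | inr (r, s) => inr (ref_at t i r, s)
    end.
  rewrite /template_attach /attach /tprem1 /tprem2 /tconc1 /tconc2 /at_clause /pos /neg.
  by case: k => [|[|[|[|k]]]] //; case: (template_body tm) => [[[?|] [?|]] [[?|] [?|]]].
have pairE t i t' i' : unary env t /\ unary env i -> unary env t' /\ unary env i' ->
    feval env (FAnd (f_eq t t') (f_eq i i')) =
    ((cval env t, cval env i) == (cval env t', cval env i')).
  by move=> [ut ui] [ut' ui']; rewrite fevalA !f_eqE.
case: u => [p|t i [[x s]|[tm k]]]; case: v => [q|t' i' [[y s']|[tm' l]]] // cu cv;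
  rewrite /f_arc.
- rewrite fevalA fevalC pairE // [RHS]/= !xpair_eqE -!andbA.
  by case: (x == y); rewrite ?andbF //= andbA andbC -andbA.
- case: cu => ut ui; rewrite fevalA f_activeE // [RHS]/= att; congr andb.
  by case: template_attach => [p|[r s]].
- case: cu => ut ui; case: cv => ut' ui'.
  rewrite fevalA f_activeE // [RHS]/= att; congr andb.
  by case: template_attach => [p|[r s]] //; rewrite f_refE.
- rewrite fevalA fevalC pairE // [RHS]/= !xpair_eqE -!andbA.
  by case: (tm == tm'); rewrite ?andbF //= andbA andbC -andbA.
Qed.

Lemma f_adjE u v : counters u -> counters v ->
  feval env (f_adj u v) = tadj z0 Zb N (node_of u) (node_of v).
Proof. by move=> cu cv; rewrite f_orE !f_arcE. Qed.

End Correctness.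
End GraphProgram.

(** * The reduction *)

Lemma flatten_map_flatten (I A B : Type) (g : A -> seq B) (F : I -> seq A) (s : seq I) :
  flatten [seq g u | u <- flatten [seq F i | i <- s]] =
  flatten [seq flatten [seq g u | u <- F i] | i <- s].
Proof. by elim: s => //= i s IH; rewrite map_cat flatten_cat IH. Qed.

Section PrintGraph.
Variable M : TM.

Definition for_node (d : nat) (body : vterm M -> prog) : prog :=
  PSeq (pseq [seq body (TPal M p) | p <- iota 0 15])
       (PFor 4 (PFor 4 (pseq [seq body (TLoc d d.+1 l) | l <- locs M]))).

(** Levels 0 to 4 hold the input and the computed strings. The inner loops start at level 7 inside
    the two loops of a tableau vertex, but at level 5 for a palette vertex. *)
Definition node_depth (u : vterm M) : nat := if u is TLoc _ _ _ then 7 else 5.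

Definition graph_prog : prog :=
  PSeq (for_node 5 (fun=> ptrue))
    (PSeq (POut (FConst false))
      (for_node 5 (fun u => for_node (node_depth u) (fun v => POut (f_adj u v))))).

(** Serves for the unary number of vertices, for the rows of the matrix and for the entries of a
    row. *)
Lemma out_for_node env d N body (g : tnode M -> seq bool) :
  size env = d -> 4 < d -> size (nth [::] env 4) = N ->
  (forall p, p < 15 -> out env (body (TPal M p)) = g (Pal _ _ p)) ->
  (forall t i l, out (rcons (rcons env (nseq t true)) (nseq i true))
     (body (TLoc d d.+1 l)) = g (place t i l)) ->
  out env (for_node d body) = flatten [seq g u | u <- nodes M N].
Proof.
move=> <- h4 hN Hp Hl.
have outS p q : out env (PSeq p q) = out env p ++ out env q by [].
rewrite /nodes map_cat flatten_cat -map_comp outS out_pseq -map_comp.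
congr (flatten _ ++ _).
  by apply/eq_in_map => p; rewrite mem_iota => hp; exact: Hp.
rewrite flatten_map_flatten [out _ _]/= hN; congr flatten; apply: eq_map => t.
rewrite flatten_map_flatten nth_rcons h4 hN; congr flatten; apply: eq_map => i.
by rewrite out_pseq -!map_comp; congr flatten; apply: eq_map => l; exact: Hl.
Qed.

Section Output.
Variables (z0 : seq bool) (Zb N : nat) (x : seq bool).
Let env := [:: x; z0; nseq (size z0) true; nseq Zb true; nseq N true].

Lemma out_graph_prog :
  out env graph_prog = enc_graph (tedge z0 Zb (N := N) (M := M)).
Proof.
have outO env' f : out env' (POut f) = [:: feval env' f] by [].
have sN : size (nth [::] env 4) = N by rewrite /= size_nseq.
have -> : out env graph_prog = out env (for_node 5 (fun=> ptrue)) ++ false ::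
    out env (for_node 5 (fun u => for_node (node_depth u) (fun v => POut (f_adj u v)))).
  by [].
have := @out_for_node env 5 N (fun=> ptrue) (fun=> [:: true]) erefl isT sN.
move=> -> //; rewrite flatten_map1 map_const.
congr (_ ++ _ :: _).
have := @out_for_node env 5 N (fun u => for_node (node_depth u) (fun v => POut (f_adj u v)))
   (fun u => [seq tadj z0 Zb N u v | v <- nodes M N]) erefl isT sN.
move=> ->.
- set I := enum 'I_(size (nodes M N)).
  have nodesE : [seq nth (Pal _ _ 0) (nodes M N) (val i) | i <- I] = nodes M N.
    by rewrite (map_comp (nth _ _) val) val_enum_ord map_nth_iota0 ?take_size.
  transitivity (flatten [seq [seq tadj z0 Zb N u v |
      v <- [seq nth (Pal _ _ 0) (nodes M N) (val j) | j <- I]] |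
      u <- [seq nth (Pal _ _ 0) (nodes M N) (val i) | i <- I]]).
    by rewrite nodesE.
  by rewrite -map_comp; congr flatten; apply: eq_map => i; rewrite /= -map_comp.
- move=> p hp.
  have := @out_for_node env 5 N (fun v => POut (f_adj (TPal M p) v))
    (fun v => [:: tadj z0 Zb N (Pal _ _ p) v]) erefl isT sN.
  rewrite flatten_map1; apply.
    by move=> q hq; rewrite outO (@f_adjE _ z0 Zb N).
  by move=> t i l; rewrite outO (@f_adjE _ z0 Zb N) //= /unary /cval /= !size_nseq.
- move=> t i l; set env' := rcons _ _.
  have sN' : size (nth [::] env' 4) = N by rewrite /= size_nseq.
  have := @out_for_node env' 7 N (fun v => POut (f_adj (TLoc 5 6 l) v))
    (fun v => [:: tadj z0 Zb N (place t i l) v]) erefl isT sN'.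
  rewrite flatten_map1; apply.
    by move=> q hq; rewrite outO (@f_adjE _ z0 Zb N) //= /unary /cval /= !size_nseq.
  by move=> t' i' l'; rewrite outO (@f_adjE _ z0 Zb N) //= /unary /cval /= !size_nseq.
Qed.

End Output.
End PrintGraph.

Section Reduction.
Variables (M : TM) (a k b m : nat).

(** Only the input is bound at this stage, so level 1 is the loop counter. *)
Definition prefix_prog : prog :=
  PSeq (PFor 0 (PSeq ptrue (POut (FLook 0 1 false)))) (POut (FConst false)).

Definition bound_prog : prog :=
  PSeq (PFor 1 ptrue) (PSeq (pseq (nseq b (iter m (PFor 0) ptrue))) (pseq (nseq b ptrue))).

Definition tableau_prog : prog :=
  PSeq (pseq (nseq a (iter k (PFor 3) ptrue)))
    (PSeq (pseq (nseq a ptrue)) (PSeq (PFor 3 ptrue) ptrue)).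

Definition reduction_progs : seq prog :=
  [:: prefix_prog; PFor 1 ptrue; bound_prog; tableau_prog; graph_prog M].

Definition zprefix (x : seq bool) : seq bool := pair_enc x [::].
Definition zbound (x : seq bool) : nat := size (zprefix x) + (b * size x ^ m + b).
(** The verifier's time bound on inputs of length [zbound x], plus [zbound x + 1]: the table
    outlasts the computation and is wide enough for the input. *)
Definition tsize (x : seq bool) : nat := a * zbound x ^ k + (a + (zbound x + 1)).

Lemma out_prefix_prog x : out [:: x] prefix_prog = zprefix x.
Proof.
rewrite /zprefix /pair_enc /=; congr (flatten _ ++ _).
rewrite -[in RHS](mkseq_nth false x) /mkseq -map_comp; apply: eq_map => i /=.
by rewrite size_nseq addn0.
Qed.

Lemma out_bound_prog x z u : size z = size (zprefix x) ->
  out [:: x; z; u] bound_prog = nseq (zbound x) true.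
Proof.
move=> hz; set env := [:: x; z; u].
have -> : out env bound_prog = out env (PFor 1 ptrue) ++
   (out env (pseq (nseq b (iter m (PFor 0) ptrue))) ++ out env (pseq (nseq b ptrue))) by [].
rewrite out_unary // (@out_repeat _ _ _ (size x ^ m)) ?out_power //.
by rewrite (@out_repeat _ _ _ 1) // muln1 -!nseqD /zbound -hz.
Qed.

Lemma out_tableau_prog x z u : 
  out [:: x; z; u; nseq (zbound x) true] tableau_prog = nseq (tsize x) true.
Proof.
set env := [:: x; _; _; _].
have e3 : size (nth [::] env 3) = zbound x by rewrite /= size_nseq.
have -> : out env tableau_prog = out env (pseq (nseq a (iter k (PFor 3) ptrue))) ++
  (out env (pseq (nseq a ptrue)) ++ (out env (PFor 3 ptrue) ++ out env ptrue)) by [].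
rewrite out_unary // (@out_repeat _ _ _ (zbound x ^ k)) ?out_power ?e3 //.
by rewrite (@out_repeat _ _ _ 1) // muln1 -[out env ptrue]/(nseq 1 true) -!nseqD.
Qed.

Lemma reduction_output x :
  last [::] (lets [:: x] reduction_progs) =
  enc_graph (tedge (zprefix x) (zbound x) (N := tsize x) (M := M)).
Proof.
rewrite /lets /reduction_progs /foldl out_prefix_prog.
rewrite -[rcons [:: x] _]/[:: x; zprefix x] out_unary //.
rewrite -[rcons [:: x; _] _]/[:: x; zprefix x; nseq (size (zprefix x)) true].
rewrite out_bound_prog //.
rewrite -[rcons [:: x; _; _] _]/[:: x; zprefix x; nseq (size (zprefix x)) true; nseq (zbound x) true].
by rewrite out_tableau_prog last_rcons out_graph_prog.
Qed.

End Reduction.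

(* NP-hardness of the (promise) problem "given a triangle-free graph G,
   decide whether G is perfectly divisible": every NP language reduces,
   by a polynomial-time many-one reduction, to it; the reduction always
   outputs (the encoding of) a triangle-free simple graph. *)
Theorem theorem5 :
  forall L : pred (seq bool), in_NP L ->
  exists f : seq bool -> seq bool, polytime_fun f /\
    forall x : seq bool, exists (n : nat) (e : rel 'I_n),
      [/\ symmetric e, irreflexive e, triangle_free e,
          f x = enc_graph e &
          (L x <-> perfectly_divisible e)].
Proof.
move=> L [M [a [k [b [m [Mhalts LE]]]]]].
exists (fun x => last [::] (lets [:: x] (reduction_progs M a k b m))).
split; first exact: loop_polytime.
move=> x; set z0 := zprefix x; set Zb := zbound b m x; set N := tsize a k b m x.
exists (size (nodes M N)), (@tedge M z0 Zb N); split.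
- exact: tedge_sym.
- exact: tedge_irr.
- exact: tedge_triangle_free.
- exact: reduction_output.
have z0_gt0 : 0 < size z0 by rewrite /z0 /zprefix /pair_enc size_cat /= addn1.
have pairE y : pair_enc x y = z0 ++ y by rewrite /z0 /zprefix /pair_enc -catA.
pose T := a * Zb ^ k + a.
have T_lt : T < N by rewrite /T /N /tsize -/Zb; lia.
have Zb_le : Zb <= N by rewrite /N /tsize -/Zb; lia.
have z0_le : size z0 <= Zb by rewrite /Zb /zbound leq_addr.
(* The time bound increases with the length of the input and halted configurations stay, so the
   single time [T] serves all certificates. *)
have haltT y : size z0 + size y <= Zb -> halted (run T (init M (z0 ++ y))).
  move=> hy; have [t [ht h]] := Mhalts (z0 ++ y).
  rewrite (@run_halted M z0 y t T h) //; apply: leq_trans ht _.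
  rewrite leq_add2r leq_mul2l; apply/orP; right.
  by case: (k) => // k'; rewrite leq_exp2r // size_cat.
rewrite (perfectly_divisible_3col (@tedge_sym M z0 Zb N) (@tedge_irr M z0 Zb N));
  last exact: tedge_triangle_free.
rewrite three_colorable_sat LE; split=> [[y [hy [t [ht acc]]]]|[val H]].
  rewrite pairE in ht acc.
  (* The accepting time [t] may lie beyond the table: the valuation describes the run itself, and
     clauses only forbid rejection. *)
  exists (@run_val M z0 y) => t' i tm _ _.
  apply: (@run_val_sat M z0 Zb N y t) => //.
  by rewrite /Zb /zbound leq_add2l.
have hg : size z0 + size (guess z0 Zb val) <= Zb by exact: size_guess.
exists (guess z0 Zb val); split; first by move: hg; rewrite {2}/Zb /zbound leq_add2l.
(* Here the verifier has halted within the table, where rejection is forbidden. *)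
exists T; rewrite pairE; have hT := haltT _ hg; split=> //.
exact: (tableau_accepts z0_gt0 z0_le Zb_le H T_lt hT).
Qed.
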